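(* Let $G$ be a finite group, let $\rho$ and $\sigma$ be states on finite-dimensional input and output systems with Hamiltonians $H$ and $H'$, and let $U$ and $U'$ be projective unitary representations of $G$ on the input and output spaces with $[U(g),H]=0$ and $[U'(g),H']=0$ for all $g\in G$. Fix an inverse temperature $\beta>0$. Then $$R_{G\text{-}\mathrm{cov},\mathrm{GP}}(\rho\to\sigma)=\begin{cases}R_{\mathrm{GP}}(\rho\to\sigma)&\text{if }\mathrm{Sym}_{G,U}(\rho)\subset\mathrm{Sym}_{G,U'}(\sigma),\\0&\text{otherwise.}\end{cases}$$
   Context: $\mathrm{Sym}_{G,U}(\rho):=\{g\in G\mid U(g)\rho U(g)^\dagger=\rho\}$, similarly for $\sigma$ and $U'$. For a system with Hamiltonian $H$ the Gibbs state is $\gamma(\beta)=e^{-\beta H}/\mathrm{tr}(e^{-\beta H})$. On $n$ copies the Hamiltonian is $H^{(n)}=\sum_{j=1}^nI^{\otimes j-1}\otimes H\otimes I^{\otimes n-j}$ and the representation is $U(g)^{\otimes n}$ (similarly for the output). A channel is Gibbs preserving (GP) if it maps the Gibbs state of the input system to the Gibbs state of the output system, both at inverse temperature $\beta$. A channel is $G$-covariant if it intertwines the conjugation actions of $G$ on input and output. For a class $\mathcal{O}$ of channels, $R_{\mathcal{O}}(\rho\to\sigma)$ is the supremum of all $r\ge0$ for which there are $\mathcal{E}^{(n)}\in\mathcal{O}$ from $n$ input copies to $\lfloor rn\rfloor$ output copies with $\frac12\|\mathcal{E}^{(n)}(\rho^{\otimes n})-\sigma^{\otimes\lfloor rn\rfloor}\|_1\to0$.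 $R_{\mathrm{GP}}$ and $R_{G\text{-}\mathrm{cov},\mathrm{GP}}$ are the rates for Gibbs-preserving channels and for $G$-covariant Gibbs-preserving channels. *)

(* Defs.v *)
From mathcomp Require Import all_boot all_order all_algebra all_fingroup.
From mathcomp Require Import classical_sets reals ereal topology normedtype.
From mathcomp Require Import sequences exp.
From mathcomp Require Import complex.
(* Not imported: its notation A ^t k clashes with the sesquilinear A ^t*. *)
From mathcomp Require mxtens.

Set Implicit Arguments.
Unset Strict Implicit.
Unset Printing Implicit Defensive.

Import Order.TTheory GRing.Theory Num.Theory.
Import numFieldNormedType.Exports.
Local Open Scope ring_scope.
Local Open Scope complex_scope.
Local Open Scope sesquilinear_scope.
Local Open Scope classical_set_scope.

(* A system of dimension d is C^d with C = R[i]; operators on it are d x d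
   matrices, and n copies of it live in dimension d ^ n, with the tensor
   products tensmx and ntensmx of mxtens. *)
Local Notation "A *t B" := (mxtens.tensmx A B) (at level 40).

(* In the order of R[i], 0 <= z means that z is real and nonnegative; hence
   this condition includes that A is Hermitian. *)
Definition psd (R : realType) d (A : 'M[R[i]]_d) : Prop :=
  forall v : 'cV[R[i]]_d, 0 <= (v ^t* *m A *m v) 0 0.

Definition is_state (R : realType) d (rho : 'M[R[i]]_d) : Prop :=
  psd rho /\ \tr rho = 1.

(* Functional calculus: f(A) = \sum_i f(a_i) |a_i><a_i| for Hermitian A with
   eigenvalues a_i (which are real) and orthonormal eigenvectors |a_i>. *)
Definition herm_fun (R : realType) (f : R -> R) d (A : 'M[R[i]]_d) :
    'M[R[i]]_d :=
  invmx (spectralmx A)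
  *m diag_mx (map_mx (fun z : R[i] => (f (complex.Re z))%:C) (spectral_diag A))
  *m spectralmx A.

(* ||A||_1 = tr sqrt(A^* A) *)
Definition trace_norm (R : realType) d (A : 'M[R[i]]_d) : R :=
  complex.Re (\tr (herm_fun (@Num.sqrt R) (A ^t* *m A))).

Definition gibbs (R : realType) (beta : R) d (H : 'M[R[i]]_d) : 'M[R[i]]_d :=
  let E := herm_fun (@expR R) (- beta%:C *: H) in (\tr E)^-1 *: E.

(* tensfam A n = A 0 *t A 1 *t ... *t A n.-1 *)
Fixpoint tensfam_rec (R : realType) d (A : nat -> 'M[R[i]]_d) k :
    'M[R[i]]_(d ^ k.+1) :=
  if k is k'.+1 then A 0%N *t tensfam_rec (fun i => A i.+1) k' else A 0%N.

Definition tensfam (R : realType) d (A : nat -> 'M[R[i]]_d) n :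
    'M[R[i]]_(d ^ n) :=
  if n is k.+1 return 'M[R[i]]_(d ^ n) then tensfam_rec A k else 1.

Definition copies_ham (R : realType) d (H : 'M[R[i]]_d) n :
    'M[R[i]]_(d ^ n) :=
  \sum_(j < n) tensfam (fun i => if i == j then H else 1%:M) n.

(* (id_k (x) E)(X) = \sum_(i, j) |i><j| (x) E(X_ij) for the block
   decomposition X = \sum_(i, j) |i><j| (x) X_ij *)
Definition ampliation (R : realType) a b k (E : 'M[R[i]]_a -> 'M[R[i]]_b)
    (X : 'M[R[i]]_(k * a)) : 'M[R[i]]_(k * b) :=
  \sum_(i < k) \sum_(j < k) delta_mx i j *t
    E (\matrix_(p, q) X (mxtens.mxtens_index (i, p))
                        (mxtens.mxtens_index (j, q))).

Record is_channel (R : realType) a b (E : 'M[R[i]]_a -> 'M[R[i]]_b) : Prop :=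
  IsChannel {
    channel_linear : linear E;
    channel_cp : forall k (X : 'M[R[i]]_(k * a)), psd X -> psd (ampliation E X);
    channel_tp : forall X, \tr (E X) = \tr X
  }.

Definition proj_unitary_rep (R : realType) (G : finGroupType) d
    (U : G -> 'M[R[i]]_d) : Prop :=
  (forall g, U g \is unitarymx) /\
  (forall g h, exists2 w : R[i], `|w| = 1 & U g *m U h = w *: U (g * h)%g).

Definition sym_group (R : realType) (G : finGroupType) d
    (U : G -> 'M[R[i]]_d) (rho : 'M[R[i]]_d) : {set G} :=
  [set g | U g *m rho *m (U g) ^t* == rho]%SET.

Definition covariant (R : realType) (G : finGroupType) a b
    (U : G -> 'M[R[i]]_a) (U' : G -> 'M[R[i]]_b)
    (E : 'M[R[i]]_a -> 'M[R[i]]_b) : Prop :=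
  forall g X, E (U g *m X *m (U g) ^t*) = U' g *m E X *m (U' g) ^t*.

Definition gibbs_preserving (R : realType) (beta : R) a b
    (H : 'M[R[i]]_a) (H' : 'M[R[i]]_b) (E : 'M[R[i]]_a -> 'M[R[i]]_b) : Prop :=
  E (gibbs beta H) = gibbs beta H'.

(* The class O n m E constrains the channels E from n input copies to m output
   copies. The rate may be +oo. *)
Definition rate (R : realType) d d'
    (O : forall n m, ('M[R[i]]_(d ^ n) -> 'M[R[i]]_(d' ^ m)) -> Prop)
    (rho : 'M[R[i]]_d) (sigma : 'M[R[i]]_d') : \bar R :=
  ereal_sup [set r%:E | r in [set r : R | 0 <= r /\
    let m n := Num.truncn (r * n%:R) in
    exists E : forall n, 'M[R[i]]_(d ^ n) -> 'M[R[i]]_(d' ^ m n),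
      (forall n, is_channel (E n) /\ O n (m n) (E n)) /\
      (fun n => 2^-1 * trace_norm
                  (E n (mxtens.ntensmx rho n) - mxtens.ntensmx sigma (m n)))
        @ \oo --> (0 : R)]].

Definition GP_class (R : realType) (beta : R) d d'
    (H : 'M[R[i]]_d) (H' : 'M[R[i]]_d') n m
    (E : 'M[R[i]]_(d ^ n) -> 'M[R[i]]_(d' ^ m)) : Prop :=
  gibbs_preserving beta (copies_ham H n) (copies_ham H' m) E.

Definition cov_GP_class (R : realType) (G : finGroupType) (beta : R) d d'
    (U : G -> 'M[R[i]]_d) (U' : G -> 'M[R[i]]_d')
    (H : 'M[R[i]]_d) (H' : 'M[R[i]]_d') n m
    (E : 'M[R[i]]_(d ^ n) -> 'M[R[i]]_(d' ^ m)) : Prop :=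
  covariant (fun g => mxtens.ntensmx (U g) n)
            (fun g => mxtens.ntensmx (U' g) m) E /\
  GP_class beta H H' E.

Definition R_GP (R : realType) (beta : R) d d'
    (H : 'M[R[i]]_d) (H' : 'M[R[i]]_d')
    (rho : 'M[R[i]]_d) (sigma : 'M[R[i]]_d') : \bar R :=
  rate (@GP_class R beta d d' H H') rho sigma.

Definition R_cov_GP (R : realType) (G : finGroupType) (beta : R) d d'
    (U : G -> 'M[R[i]]_d) (U' : G -> 'M[R[i]]_d')
    (H : 'M[R[i]]_d) (H' : 'M[R[i]]_d')
    (rho : 'M[R[i]]_d) (sigma : 'M[R[i]]_d') : \bar R :=
  rate (@cov_GP_class R G beta d d' U U' H H') rho sigma.

(* Main.v *)
(* If g fixes rho but not sigma, a covariant channel sends rho^(x)n to a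
   g-invariant operator, which stays at a fixed trace distance from
   sigma^(x)m for every m > 0: test against B (x) 1 (x) ... (x) 1 with
   B = sigma - g.sigma. Hence only the rate 0 (discard everything) is left.

   Otherwise the symmetry of rho is a symmetry of sigma. Given Gibbs-preserving
   channels of rate r and r' < r, spend a fraction 1 - r' / r of the input
   copies on a measurement which guesses the element g.rho of the finite orbit
   of rho with error O(1/n) (a single two-outcome measurement separates the
   orbit, and repeating it obeys Chebyshev's inequality). Depending on the
   guess, conjugate the given channel by g, discard the superfluous output
   copies and average the result over G. Invariance of the Gibbs states and
   their multiplicativity make the average Gibbs preserving, whatever the
   measurement. On g.rho the guess is right up to the stabilizer of rho, which
   is harmless because the stabilizer also fixes sigma. *)

Require Import Defs.
From mathcomp Require Import all_boot all_order all_algebra all_fingroup.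
From mathcomp Require Import classical_sets reals ereal topology normedtype.
From mathcomp Require Import sequences exp.
From mathcomp Require Import complex.
From mathcomp Require mxtens.
From mathcomp Require Import ring lra.
Set Implicit Arguments.
Unset Strict Implicit.
Unset Printing Implicit Defensive.

Import Order.TTheory GRing.Theory Num.Theory.
Import numFieldNormedType.Exports.
Local Open Scope ring_scope.
Local Open Scope complex_scope.
Local Open Scope sesquilinear_scope.
Local Open Scope classical_set_scope.

Local Notation "A *t B" := (mxtens.tensmx A B) (at level 40).
Local Notation tidx := mxtens.mxtens_index.
Local Notation nt := mxtens.ntensmx.

(** * Adjoints and functional calculus *)

Section Adjoint.
Variable R : realType.
Local Notation C := R[i].

Lemma adjM m n p (A : 'M[C]_(m, n)) (B : 'M_(n, p)) :
  (A *m B)^t* = B^t* *m A^t*.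
Proof. by rewrite trmx_mul map_mxM. Qed.

Lemma adjD m n (A B : 'M[C]_(m, n)) : (A + B)^t* = A^t* + B^t*.
Proof. by rewrite linearD /= map_mxD. Qed.

Lemma adjB m n (A B : 'M[C]_(m, n)) : (A - B)^t* = A^t* - B^t*.
Proof. by rewrite linearB /= map_mxB. Qed.

Lemma adjZ m n a (A : 'M[C]_(m, n)) : (a *: A)^t* = a^*%R *: A^t*.
Proof. by rewrite linearZ /= map_mxZ. Qed.

Lemma adj1 n : (1%:M : 'M[C]_n)^t* = 1%:M.
Proof. by rewrite trmx1 map_mx1. Qed.

Lemma adj_tens m n p q (A : 'M[C]_(m, n)) (B : 'M[C]_(p, q)) :
  (A *t B)^t* = A^t* *t B^t*.
Proof. by apply/matrixP=> i j; rewrite !mxE rmorphM. Qed.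

Lemma adjE m n (A : 'M[C]_(m, n)) i j : A^t* i j = (A j i)^*%R.
Proof. by rewrite !mxE. Qed.

Lemma conj_real (x : R) : (x%:C : C)^*%R = x%:C.
Proof. by apply: conj_Creal; rewrite complex_real. Qed.

Lemma rcD (x y : R) : (x + y)%:C = x%:C + y%:C :> C.
Proof. exact: rmorphD. Qed.

Lemma rcB (x y : R) : (x - y)%:C = x%:C - y%:C :> C.
Proof. exact: rmorphB. Qed.

Lemma rcN (x : R) : (- x)%:C = - x%:C :> C.
Proof. exact: rmorphN. Qed.

Lemma rcM (x y : R) : (x * y)%:C = x%:C * y%:C :> C.
Proof. exact: rmorphM. Qed.

Definition rdiag d (a : 'I_d -> R) : 'M[C]_d :=
  diag_mx (\row_i (a i)%:C).

Lemma rdiagE d (a : 'I_d -> R) i j : rdiag a i j = (a i)%:C *+ (i == j).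
Proof. by rewrite /rdiag !mxE. Qed.

Lemma adj_rdiag d (a : 'I_d -> R) : (rdiag a)^t* = rdiag a.
Proof.
apply/matrixP=> i j; rewrite adjE !rdiagE rmorphMn /= conj_real eq_sym.
by case: eqP => // ->.
Qed.

Lemma rdiagM d (a b : 'I_d -> R) : rdiag a *m rdiag b = rdiag (fun i => a i * b i).
Proof.
rewrite /rdiag mulmx_diag; congr diag_mx; apply/rowP=> i.
by rewrite !mxE rmorphM.
Qed.

Lemma rdiagD d (a b : 'I_d -> R) : rdiag a + rdiag b = rdiag (fun i => a i + b i).
Proof. by apply/matrixP=> i j; rewrite !mxE rmorphD mulrnDl. Qed.

Lemma rdiagB d (a b : 'I_d -> R) : rdiag a - rdiag b = rdiag (fun i => a i - b i).
Proof. by apply/matrixP=> i j; rewrite !mxE rmorphB mulrnBl. Qed.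

Lemma rdiag_const d (c : R) : rdiag (fun _ : 'I_d => c) = (c%:C)%:M.
Proof. by apply/matrixP=> i j; rewrite !mxE. Qed.

Lemma trace_rdiag d (a : 'I_d -> R) : \tr (rdiag a) = (\sum_i a i)%:C.
Proof.
by rewrite mxtrace_diag rmorph_sum; apply: eq_bigr => i _; rewrite mxE.
Qed.

Lemma unitaryVK d (V : 'M[C]_d) : V \is unitarymx -> V^t* *m V = 1%:M.
Proof. by move=> Vu; rewrite -(mul1mx (V^t*)) mulmxKtV. Qed.

Lemma unitaryKV d (V : 'M[C]_d) : V \is unitarymx -> V *m V^t* = 1%:M.
Proof. by move/unitarymxP. Qed.

Lemma tens11 a b : (1%:M : 'M[C]_a) *t (1%:M : 'M_b) = 1%:M.
Proof.
apply/matrixP=> i j; case: (mxtens.mxtens_indexP i) => i1 i2.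
case: (mxtens.mxtens_indexP j) => j1 j2; rewrite mxtens.tensmxE !mxE.
by rewrite -natrM mulnb (can_eq (@mxtens.mxtens_indexK _ _)) xpair_eqE.
Qed.

Lemma unitary_tens a b (V : 'M[C]_a) (W : 'M[C]_b) :
  V \is unitarymx -> W \is unitarymx -> V *t W \is unitarymx.
Proof.
move=> /unitarymxP VK /unitarymxP WK; apply/unitarymxP.
by rewrite adj_tens mxtens.tensmx_mul VK WK tens11.
Qed.

Lemma trace_conj_unitary d (V A : 'M[C]_d) :
  V \is unitarymx -> \tr (V *m A *m V^t*) = \tr A.
Proof. by move=> Vu; rewrite mxtrace_mulC mulmxA unitaryVK // mul1mx. Qed.

Lemma trace_conj_unitaryV d (V A : 'M[C]_d) :
  V \is unitarymx -> \tr (V^t* *m A *m V) = \tr A.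
Proof. by move=> Vu; rewrite mxtrace_mulC mulmxA unitaryKV // mul1mx. Qed.

(** The spectrum is real, so the diagonal comes from a real function; [A] and its image under [f]
    share one eigenbasis. *)
Lemma herm_spectral (f : R -> R) d (A : 'M[C]_d) : A^t* = A ->
  exists V : 'M_d, V \is unitarymx /\ exists a, A = V^t* *m rdiag a *m V /\
    herm_fun f A = V^t* *m rdiag (fun i => f (a i)) *m V.
Proof.
move=> Ah.
have Aherm : A \is hermsymmx by apply/is_hermitianmxP; rewrite expr0 scale1r Ah.
have /orthomx_spectralP := hermitian_normalmx Aherm.
have /mxOverP := hermitian_spectral_diag_real Aherm.
rewrite /herm_fun.
have := spectral_unitarymx A; move: (spectralmx A) (spectral_diag A) => P s Pu.
rewrite (invmx_unitary Pu) => sr AE.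
have sE : diag_mx s = rdiag (fun i => complex.Re (s 0 i)).
  apply: (congr1 (@diag_mx _ _)); apply/rowP=> i.
  by rewrite mxE; apply/esym/RRe_real.
have fE : map_mx (fun z => (f (complex.Re z))%:C) s =
    \row_i (f (complex.Re (s 0 i)))%:C.
  by apply/rowP=> i; rewrite !mxE.
exists P; split=> //; exists (fun i => complex.Re (s 0 i)).
by split; [rewrite -sE | rewrite fE].
Qed.

Lemma herm_diag d (A : 'M[C]_d) : A^t* = A ->
  exists V : 'M_d, V \is unitarymx /\ exists a, A = V^t* *m rdiag a *m V.
Proof.
by move=> /(herm_spectral id) [V [Vu [a [AE _]]]]; exists V; split=> //; exists a.
Qed.

(** Entrywise the hypothesis reads (a_i - b_j) W_ij = 0, so a_i = b_j, and hence f a_i = f b_j,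
    wherever W_ij is nonzero. *)
Lemma intertwine_fun (f : R -> R) d d' (W : 'M[C]_(d, d')) a b :
  rdiag a *m W = W *m rdiag b ->
  rdiag (fun i => f (a i)) *m W = W *m rdiag (fun i => f (b i)).
Proof.
move=> E; apply/matrixP=> i j.
have := congr1 (fun M : 'M_(_, _) => M i j) E.
rewrite /rdiag !mul_diag_mx !mul_mx_diag !mxE.
have [->|W0] := eqVneq (W i j) 0; first by rewrite !mulr0 !mul0r.
rewrite mulrC => /(mulfI W0) /complexI ->; exact: mulrC.
Qed.

(** Functional calculus does not depend on the diagonalization: the change of basis to the one
    inside [herm_fun] intertwines the two diagonals, hence also their images under [f]. *)
Lemma herm_funE (f : R -> R) d (V : 'M[C]_d) a : V \is unitarymx ->
  herm_fun f (V^t* *m rdiag a *m V) = V^t* *m rdiag (fun i => f (a i)) *m V.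
Proof.
move=> Vu; set A := V^t* *m _ *m _.
have Ah : A^t* = A by rewrite /A !adjM adj_rdiag trmxCK mulmxA.
have [P [Pu [s [AE ->]]]] := herm_spectral f Ah.
have WE : rdiag s *m (P *m V^t*) = (P *m V^t*) *m rdiag a.
  have : P *m A *m V^t* = P *m A *m V^t* by [].
  rewrite {1}AE /A !mulmxA (unitaryKV Pu) mul1mx => ->.
  by rewrite -(mulmxA (P *m V^t* *m _)) (unitaryKV Vu) mulmx1.
have /(congr1 (fun M => P^t* *m M *m V)) := intertwine_fun f WE.
by rewrite !mulmxA (unitaryVK Pu) mul1mx -mulmxA (unitaryVK Vu) mulmx1.
Qed.

End Adjoint.

(** * Positive matrices and the trace norm *)

Section Positive.
Variable R : realType.
Local Notation C := R[i].

Lemma adj_mx11 (M : 'M[C]_1) : M^t* 0 0 = (M 0 0)^*%R.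
Proof. exact: adjE. Qed.

Lemma qf_adj d (A : 'M[C]_d) (v : 'cV_d) :
  (v^t* *m A^t* *m v) 0 0 = ((v^t* *m A *m v) 0 0)^*%R.
Proof. by rewrite -adj_mx11 !adjM trmxCK mulmxA. Qed.

Lemma qf_delta d (A : 'M[C]_d) i :
  ((delta_mx i 0 : 'cV_d)^t* *m A *m (delta_mx i 0 : 'cV_d)) 0 0 = A i i.
Proof.
rewrite trmx_delta map_delta_mx -rowE mxE (bigD1 i) //= !mxE !eqxx mulr1 big1.
  by rewrite addr0.
by move=> j /negPf ji; rewrite !mxE ji mulr0.
Qed.

Lemma qf_spectral d (V : 'M[C]_d) a i : V \is unitarymx ->
  let v := V^t* *m (delta_mx i 0 : 'cV_d) in
  (v^t* *m (V^t* *m rdiag a *m V) *m v) 0 0 = (a i)%:C.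
Proof.
move=> Vu v; rewrite /v adjM trmxCK !mulmxA -(mulmxA _ V (V^t*)).
rewrite (unitaryKV Vu) mulmx1 -(mulmxA _ V (V^t*)) (unitaryKV Vu) mulmx1.
by rewrite qf_delta rdiagE eqxx.
Qed.

(** A nonnegative quadratic form is real, so the form of the Hermitian matrix [K] vanishes; so do
    its eigenvalues, and with them [K]. *)
Lemma psd_herm d (A : 'M[C]_d) : psd A -> A^t* = A.
Proof.
move=> Apsd; pose K : 'M[C]_d := 'i%C *: (A - A^t*).
have iJ : ('i%C : C)^*%R = - 'i%C.
  by apply/eqP; rewrite eq_complex /= oppr0 !eqxx.
have Kh : K^t* = K by rewrite /K adjZ adjB trmxCK iJ scaleNr -scalerN opprB.
have [V [Vu [a KE]]] := herm_diag Kh.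
have a0 i : a i = 0.
  apply: (@complexI R); rewrite -(qf_spectral a i Vu) -KE.
  set v := V^t* *m _; have := Apsd v => z0.
  rewrite /K -scalemxAr -scalemxAl mxE mulmxBr mulmxBl mxE [X in _ + X]mxE qf_adj.
  by rewrite conj_Creal ?ger0_real // subrr mulr0.
have : K = 0.
  rewrite KE (_ : rdiag a = 0) ?mulmx0 ?mul0mx //.
  by apply/matrixP=> i j; rewrite rdiagE a0 mxE mul0rn.
move=> /eqP; rewrite scaler_eq0 eq_complex /= oner_eq0 andbF /= subr_eq0.
by move=> /eqP.
Qed.

Lemma gram_psd p d (B : 'M[C]_(p, d)) : psd (B^t* *m B).
Proof.
move=> v; rewrite mulmxA -adjM -mulmxA mxE sumr_ge0 // => i _.
by rewrite adjE mulrC mul_conjC_ge0.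
Qed.

Lemma psd_spectral d (A : 'M[C]_d) : psd A ->
  exists V : 'M_d, V \is unitarymx /\ exists a, (forall i, 0 <= a i) /\
    A = V^t* *m rdiag a *m V.
Proof.
move=> Apsd; have [V [Vu [a AE]]] := herm_diag (psd_herm Apsd).
exists V; split=> //; exists a; split=> // i.
by rewrite -ler0c -(qf_spectral a i Vu) -AE; apply: Apsd.
Qed.

Lemma psd_gram d (A : 'M[C]_d) : psd A -> exists B : 'M_d, A = B^t* *m B.
Proof.
move=> /psd_spectral [V [Vu [a [a0 ->]]]].
exists (rdiag (fun i => Num.sqrt (a i)) *m V).
rewrite adjM adj_rdiag mulmxA -[in RHS](mulmxA (V^t*)) rdiagM.
rewrite (_ : rdiag a = rdiag (fun i => Num.sqrt (a i) * Num.sqrt (a i))) //.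
by apply/matrixP=> i j; rewrite !rdiagE -expr2 sqr_sqrtr.
Qed.

Lemma psd_conj p d (K : 'M[C]_(p, d)) A : psd A -> psd (K *m A *m K^t*).
Proof.
move=> /psd_gram [B ->].
rewrite (_ : _ *m _ = (B *m K^t*)^t* *m (B *m K^t*)); first exact: gram_psd.
by rewrite adjM trmxCK !mulmxA.
Qed.

Lemma psd_conjV p d (K : 'M[C]_(d, p)) A : psd A -> psd (K^t* *m A *m K).
Proof. by move=> /(psd_conj (K^t*)); rewrite trmxCK. Qed.

Lemma psdD d (A B : 'M[C]_d) : psd A -> psd B -> psd (A + B).
Proof.
by move=> Ap Bp v; rewrite mulmxDr mulmxDl mxE addr_ge0 ?Ap ?Bp.
Qed.

Lemma psd0 d : psd (0 : 'M[C]_d).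
Proof. by move=> v; rewrite mulmx0 mul0mx mxE. Qed.

Lemma psdZ d c (A : 'M[C]_d) : 0 <= c -> psd A -> psd (c *: A).
Proof.
by move=> c0 Ap v; rewrite -scalemxAr -scalemxAl mxE mulr_ge0 ?Ap.
Qed.

Lemma psd_sum d (I : Type) (s : seq I) (P : pred I) (F : I -> 'M[C]_d) :
  (forall i, P i -> psd (F i)) -> psd (\sum_(i <- s | P i) F i).
Proof. by move=> FP; apply: (@big_ind _ (@psd R d)) FP; [exact: psd0 | exact: psdD]. Qed.

Lemma psd1 d : psd (1%:M : 'M[C]_d).
Proof. by rewrite -(mul1mx 1%:M) -{1}adj1; exact: gram_psd. Qed.

Lemma psd_tens a b (A : 'M[C]_a) (B : 'M[C]_b) : psd A -> psd B -> psd (A *t B).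
Proof.
move=> /psd_gram [A' ->] /psd_gram [B' ->].
by rewrite -mxtens.tensmx_mul -adj_tens; exact: gram_psd.
Qed.

Lemma psd_diag_ge0 d (A : 'M[C]_d) i : psd A -> 0 <= A i i.
Proof. by move=> Ap; rewrite -qf_delta; exact: Ap. Qed.

Lemma psd_tr_ge0 d (A : 'M[C]_d) : psd A -> 0 <= \tr A.
Proof. by move=> Ap; apply: sumr_ge0 => i _; exact: psd_diag_ge0. Qed.

Lemma psd_trM_ge0 d (A B : 'M[C]_d) : psd A -> psd B -> 0 <= \tr (A *m B).
Proof.
move=> Ap /psd_gram [K ->]; rewrite mulmxA mxtrace_mulC mulmxA.
exact/psd_tr_ge0/psd_conj.
Qed.

Lemma psd_rdiag d (a : 'I_d -> R) : (forall i, 0 <= a i) -> psd (rdiag a).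
Proof.
move=> a0; have -> : rdiag a = (rdiag (fun i => Num.sqrt (a i)))^t* *m
    rdiag (fun i => Num.sqrt (a i)); last exact: gram_psd.
rewrite adj_rdiag rdiagM; apply/matrixP=> i j.
by rewrite !rdiagE -expr2 sqr_sqrtr.
Qed.

Lemma unitary_conj_rdiag_const d (V : 'M[C]_d) c : V \is unitarymx ->
  V^t* *m rdiag (fun=> c) *m V = (c%:C)%:M.
Proof.
by move=> Vu; rewrite rdiag_const mul_mx_scalar -scalemxAl (unitaryVK Vu) scalemx1.
Qed.

Lemma herm_bound d (A : 'M[C]_d) : A^t* = A -> exists2 c : R, 0 < c &
  psd ((c%:C)%:M - A) /\ psd ((c%:C)%:M + A).
Proof.
move=> /herm_diag [V [Vu [a ->]]].
(* The summand 1 keeps [c] positive even if all eigenvalues vanish. *)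
pose c := 1 + \sum_i `|a i|.
have ac i : `|a i| <= c.
  by rewrite /c (bigD1 i) //= addrCA ler_wpDr // addr_ge0 // sumr_ge0.
exists c; first by rewrite ltr_pwDl // sumr_ge0.
rewrite -(unitary_conj_rdiag_const c Vu) -!mulmxBl -!mulmxDl -!mulmxBr -!mulmxDr.
rewrite rdiagB rdiagD; split; apply/psd_conjV/psd_rdiag => i.
  by rewrite subr_ge0; exact: le_trans (ler_norm _) (ac i).
by have := ac i; rewrite ler_norml => /andP[]; lra.
Qed.

Lemma trace_norm_spectral d (V : 'M[C]_d) a : V \is unitarymx ->
  trace_norm (V^t* *m rdiag a *m V) = \sum_i `|a i|.
Proof.
move=> Vu; rewrite /trace_norm.
have -> : (V^t* *m rdiag a *m V)^t* *m (V^t* *m rdiag a *m V) =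
    V^t* *m rdiag (fun i => a i * a i) *m V.
  rewrite !adjM adj_rdiag trmxCK -rdiagM !mulmxA -(mulmxA _ V (V^t*)).
  by rewrite (unitaryKV Vu) mulmx1.
rewrite (herm_funE _ _ Vu) (trace_conj_unitaryV _ Vu) trace_rdiag /=.
by apply: eq_bigr => i _; rewrite -expr2 sqrtr_sqr.
Qed.

Local Opaque trace_norm.

(** Positive and negative parts of the spectrum. Together with [trace_norm_le] this makes the trace
    norm the minimum of tr P + tr N over decompositions X = P - N into positive matrices, which
    yields the triangle inequality and contractivity under channels. *)
Lemma trace_norm_jordan d (X : 'M[C]_d) : X^t* = X ->
  exists P N : 'M_d, [/\ psd P, psd N, X = P - N &
    \tr P + \tr N = (trace_norm X)%:C].
Proof.
move=> /herm_diag [V [Vu [a ->]]]; rewrite (trace_norm_spectral _ Vu).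
exists (V^t* *m rdiag (fun i => Num.max (a i) 0) *m V).
exists (V^t* *m rdiag (fun i => Num.max (- a i) 0) *m V).
split.
- by apply/psd_conjV/psd_rdiag => i; rewrite le_max lexx orbT.
- by apply/psd_conjV/psd_rdiag => i; rewrite le_max lexx orbT.
- rewrite -mulmxBl -mulmxBr rdiagB; congr (_ *m rdiag _ *m _).
  apply/boolp.funext=> i; rewrite !maxEle; do 2 case: ifP; lra.
- rewrite !(trace_conj_unitaryV _ Vu) !trace_rdiag -rcD -big_split /=.
  congr (_%:C); apply: eq_bigr=> i _.
  have [a0|a0] := lerP 0 (a i).
    by rewrite max_r ?oppr_le0 // addr0 ger0_norm.
  by rewrite max_l ?oppr_ge0 ?(ltW a0) // add0r ltr0_norm.
Qed.

Lemma normr_sub_le (x : R) (p n : C) :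
  x%:C = p - n -> 0 <= p -> 0 <= n -> `|x|%:C <= p + n.
Proof.
move=> xE p0 n0; case: (ger0P x) => _; rewrite ?rcN xE ?opprB.
  by rewrite lerD2l (le_trans _ n0) // oppr_le0.
by rewrite (addrC p) lerD2l (le_trans _ p0) // oppr_le0.
Qed.

(** In an eigenbasis of P - N each eigenvalue is a difference of two nonnegative diagonal entries,
    so its modulus is at most their sum. *)
Lemma trace_norm_le d (P N : 'M[C]_d) : psd P -> psd N ->
  (trace_norm (P - N))%:C <= \tr P + \tr N.
Proof.
move=> Pp Np.
have Xh : (P - N)^t* = P - N by rewrite adjB !psd_herm.
have [V [Vu [a XE]]] := herm_diag Xh.
rewrite XE (trace_norm_spectral _ Vu) rmorph_sum /=.
rewrite -(trace_conj_unitary P Vu) -(trace_conj_unitary N Vu).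
rewrite /mxtrace -big_split /=; apply: ler_sum => i _.
have aE : (a i)%:C = (V *m P *m V^t*) i i - (V *m N *m V^t*) i i.
  have : V *m (P - N) *m V^t* = rdiag a.
    rewrite XE !mulmxA (unitaryKV Vu) mul1mx -mulmxA (unitaryKV Vu) mulmx1 //.
  rewrite mulmxBr mulmxBl => /matrixP/(_ i i).
  by rewrite rdiagE eqxx mulr1n => <-; rewrite !mxE.
have P0 := psd_diag_ge0 i (psd_conj V Pp).
have N0 := psd_diag_ge0 i (psd_conj V Np).
exact: normr_sub_le aE P0 N0.
Qed.

Lemma trace_norm_ge0 d (X : 'M[C]_d) : X^t* = X -> 0 <= trace_norm X.
Proof.
move=> /herm_diag [V [Vu [a ->]]]; rewrite (trace_norm_spectral _ Vu).
exact: sumr_ge0.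
Qed.

Lemma trace_normD d (X Y : 'M[C]_d) : X^t* = X -> Y^t* = Y ->
  trace_norm (X + Y) <= trace_norm X + trace_norm Y.
Proof.
move=> /trace_norm_jordan [P [N [Pp Np XE TE]]].
move=> /trace_norm_jordan [P' [N' [Pp' Np' YE TE']]].
rewrite -lecR rcD.
have -> : X + Y = (P + P') - (N + N') by rewrite XE YE opprD addrACA.
apply: le_trans (trace_norm_le (psdD Pp Pp') (psdD Np Np')) _.
by rewrite !mxtraceD addrACA; apply: lerD; rewrite ?TE ?TE'.
Qed.

Lemma trace_normZ d c (X : 'M[C]_d) : 0 <= c -> X^t* = X ->
  trace_norm (c%:C *: X) <= c * trace_norm X.
Proof.
move=> c0 /trace_norm_jordan [P [N [Pp Np XE TE]]].
have -> : c%:C *: X = c%:C *: P - c%:C *: N by rewrite XE scalerBr.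
have cp : 0 <= (c%:C : C) by rewrite ler0c.
rewrite -lecR rcM; apply: le_trans (trace_norm_le (psdZ cp Pp) (psdZ cp Np)) _.
by rewrite !mxtraceZ -mulrDr TE.
Qed.

Lemma trace_norm0 d : trace_norm (0 : 'M[C]_d) <= 0.
Proof.
rewrite -lecR -(subrr 0).
by apply: le_trans (trace_norm_le (@psd0 d) (@psd0 d)) _; rewrite mxtrace0 addr0.
Qed.

Lemma trace_norm_sum d (I : Type) (s : seq I) (F : I -> 'M[C]_d) :
  (forall i, (F i)^t* = F i) ->
  trace_norm (\sum_(i <- s) F i) <= \sum_(i <- s) trace_norm (F i).
Proof.
move=> Fh.
have : (\sum_(i <- s) F i)^t* = \sum_(i <- s) F i /\
    trace_norm (\sum_(i <- s) F i) <= \sum_(i <- s) trace_norm (F i).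
  elim: s => [|i s [IHh IH]].
    by rewrite !big_nil trmx0 map_mx0; split=> //; exact: trace_norm0.
  rewrite !big_cons adjD Fh IHh; split=> //.
  by apply: le_trans (trace_normD (Fh i) IHh) _; rewrite lerD2l.
by case.
Qed.

Lemma trace_norm_states d (A B : 'M[C]_d) : is_state A -> is_state B ->
  trace_norm (A - B) <= 2.
Proof.
move=> [Ap tA] [Bp tB]; rewrite -lecR; apply: le_trans (trace_norm_le Ap Bp) _.
by rewrite tA tB -rcD.
Qed.

(** Duality with the operator norm, which enters as -c <= B <= c: in the Jordan decomposition of X
    one bound is tested on P and the other on N. *)
Lemma trace_norm_test d (X B : 'M[C]_d) (c : R) : X^t* = X ->
  psd ((c%:C)%:M - B) -> psd ((c%:C)%:M + B) ->
  \tr (B *m X) <= (c * trace_norm X)%:C.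
Proof.
move=> /trace_norm_jordan [P [N [Pp Np XE TE]]] Bm Bp.
apply: (@le_trans _ _ (c%:C * (\tr P + \tr N))); last by rewrite rcM TE.
rewrite XE mulmxBr linearB /= mulrDr.
apply: lerD.
  have := psd_trM_ge0 Bm Pp.
  by rewrite mulmxBl mul_scalar_mx linearB /= mxtraceZ subr_ge0.
have := psd_trM_ge0 Bp Np.
by rewrite mulmxDl mul_scalar_mx mxtraceD mxtraceZ -[X in _ + X]opprK subr_ge0.
Qed.

End Positive.

(** * Channels *)

Section Channels.
Variable R : realType.
Local Notation C := R[i].

Lemma sum_tidx (V : nmodType) m n (F : 'I_(m * n) -> V) :
  \sum_k F k = \sum_i \sum_j F (tidx (i, j)).
Proof.
rewrite pair_big /= (reindex (fun p : 'I_m * 'I_n => tidx p)) /=.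
  by apply: eq_bigr => -[i j].
exists (@mxtens.mxtens_unindex m n) => p _;
  [exact: mxtens.mxtens_indexK | exact: mxtens.mxtens_unindexK].
Qed.

(** The blocks used by [ampliation]. They determine the matrix, so identities between ampliations
    reduce to identities on blocks. *)
Definition tblock k a (X : 'M[C]_(k * a)) i j : 'M[C]_a :=
  \matrix_(p, q) X (tidx (i, p)) (tidx (j, q)).

Lemma tblockP k a (X Y : 'M[C]_(k * a)) :
  (forall i j, tblock X i j = tblock Y i j) -> X = Y.
Proof.
move=> XY; apply/matrixP=> p q.
case: (mxtens.mxtens_indexP p) => i1 i2; case: (mxtens.mxtens_indexP q) => j1 j2.
by have /matrixP/(_ i2 j2) := XY i1 j1; rewrite !mxE.
Qed.

Lemma tblock_tens k a (A : 'M[C]_k) (X : 'M[C]_a) i j :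
  tblock (A *t X) i j = A i j *: X.
Proof. by apply/matrixP=> p q; rewrite mxE mxtens.tensmxE !mxE. Qed.

Lemma tblock_sum k a (I : Type) (s : seq I) (F : I -> 'M[C]_(k * a)) i j :
  tblock (\sum_(t <- s) F t) i j = \sum_(t <- s) tblock (F t) i j.
Proof.
by apply/matrixP=> p q; rewrite mxE !summxE; apply: eq_bigr => t _; rewrite mxE.
Qed.

Lemma tblock_ampliation a b k (E : 'M[C]_a -> 'M[C]_b) (X : 'M[C]_(k * a)) i j :
  tblock (ampliation E X) i j = E (tblock X i j).
Proof.
rewrite /ampliation tblock_sum (bigD1 i) //= [X in _ + X]big1 ?addr0.
  rewrite tblock_sum (bigD1 j) //= [X in _ + X]big1 ?addr0.
    by rewrite tblock_tens mxE !eqxx scale1r.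
  by move=> l /negPf lj; rewrite tblock_tens mxE [j == l]eq_sym lj andbF scale0r.
move=> l /negPf li; rewrite tblock_sum big1 // => m _.
by rewrite tblock_tens mxE [i == l]eq_sym li scale0r.
Qed.

Lemma tblock_conj a b k (K : 'M[C]_(b, a)) (X : 'M[C]_(k * a)) i j :
  tblock (((1%:M : 'M_k) *t K) *m X *m ((1%:M : 'M_k) *t K)^t*) i j =
  K *m tblock X i j *m K^t*.
Proof.
apply/matrixP=> p q; rewrite mxE [LHS]mxE [RHS]mxE sum_tidx (bigD1 j) //=.
rewrite [X in _ + X]big1 ?addr0; last first.
  move=> l /negPf lj; apply: big1 => m _.
  by rewrite adj_tens adj1 mxtens.tensmxE !mxE lj mul0r mulr0.
apply: eq_bigr => m _.
rewrite adj_tens adj1 mxtens.tensmxE [X in _ * (X * _)]mxE eqxx mul1r.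
congr (_ * _); rewrite [LHS]mxE [RHS]mxE sum_tidx (bigD1 i) //=.
rewrite [X in _ + X]big1 ?addr0; last first.
  move=> l /negPf lj; apply: big1 => n _.
  by rewrite mxtens.tensmxE !mxE [i == l]eq_sym lj mul0r mul0r.
by apply: eq_bigr => n _; rewrite mxtens.tensmxE !mxE eqxx mul1r.
Qed.

(** A channel without trace preservation: a single outcome of a measurement is of this kind, and
    only the sum over outcomes preserves the trace. *)
Definition completely_positive a b (E : 'M[C]_a -> 'M[C]_b) : Prop :=
  linear E /\ forall k (X : 'M[C]_(k * a)), psd X -> psd (ampliation E X).

Lemma linear_fun0 (V W : lmodType C) (F : V -> W) : linear F -> F 0 = 0.
Proof.
by move=> lF; apply: (addrI (F 0)); have := lF 1 0 0; rewrite !scale1r !addr0.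
Qed.

Lemma linear_funZ (V W : lmodType C) (F : V -> W) a v : linear F ->
  F (a *: v) = a *: F v.
Proof.
by move=> lF; have := lF a v 0; rewrite (linear_fun0 lF) !addr0.
Qed.

Lemma linear_funB (V W : lmodType C) (F : V -> W) u v : linear F ->
  F (u - v) = F u - F v.
Proof.
by move=> lF; have := lF (-1) v u; rewrite !scaleN1r !(addrC (- _)).
Qed.

Lemma cp_positive a b (E : 'M[C]_a -> 'M[C]_b) X :
  completely_positive E -> psd X -> psd (E X).
Proof.
move=> [lE cpE] Xp; have := cpE 1%N (1%:M *t X) (psd_tens (@psd1 R 1) Xp).
(* The dimensions 1 * b and b are not convertible, so the trivial first factor is removed by
   compression with the isometry e_q -> e_(0, q). *)
move=> /(psd_conjV (\matrix_(p, q) ((p == tidx (0 : 'I_1, q))%:R : C))).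
rewrite (_ : _ *m _ = E X) //; apply/matrixP=> p q.
have -> : E X = tblock (ampliation E (1%:M *t X)) (0 : 'I_1) (0 : 'I_1).
  by rewrite tblock_ampliation tblock_tens mxE eqxx scale1r.
set Y := ampliation _ _.
rewrite [LHS]mxE (bigD1 (tidx (0, q))) //= [X in _ + X]big1 ?addr0; last first.
  by move=> l /negPf lq; rewrite !mxE lq mulr0.
rewrite [X in _ * X]mxE eqxx mulr1 [LHS]mxE (bigD1 (tidx (0, p))) //=.
rewrite [X in _ + X]big1 ?addr0; last first.
  by move=> l /negPf lp; rewrite !mxE lp conjC0 mul0r.
by rewrite !mxE eqxx conjC1 mul1r.
Qed.

Lemma cp_kraus a b (K : 'M[C]_(b, a)) :
  completely_positive (fun X => K *m X *m K^t*).
Proof.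
split=> [c X Y|k X Xp].
  by rewrite mulmxDr mulmxDl -scalemxAr -scalemxAl.
rewrite (_ : ampliation _ _ = ((1%:M : 'M_k) *t K) *m X *m
    ((1%:M : 'M_k) *t K)^t*); first exact: psd_conj.
by apply: tblockP => i j; rewrite tblock_ampliation tblock_conj.
Qed.

Lemma cp_comp a b c (F : 'M[C]_b -> 'M[C]_c) (E : 'M[C]_a -> 'M[C]_b) :
  completely_positive F -> completely_positive E ->
  completely_positive (fun X => F (E X)).
Proof.
move=> [lF Fp] [lE Ep]; split=> [k X Y|k X Xp]; first by rewrite lE lF.
rewrite (_ : ampliation _ _ = ampliation F (ampliation E X)).
  exact/Fp/Ep.
by apply: tblockP => i j; rewrite !tblock_ampliation.
Qed.

Lemma cp_sum a b (I : Type) (s : seq I) (E : I -> 'M[C]_a -> 'M[C]_b) :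
  (forall i, completely_positive (E i)) ->
  completely_positive (fun X => \sum_(i <- s) E i X).
Proof.
move=> Ep; split=> [c X Y|k X Xp].
  rewrite scaler_sumr -big_split; apply: eq_bigr => i _.
  by have [lE _] := Ep i; rewrite lE.
rewrite (_ : ampliation _ _ = \sum_(i <- s) ampliation (E i) X).
  by apply: psd_sum => i _; have [_] := Ep i; apply.
apply: tblockP => i j; rewrite tblock_ampliation tblock_sum.
by apply: eq_bigr => l _; rewrite tblock_ampliation.
Qed.

Lemma cp_scale a b c (E : 'M[C]_a -> 'M[C]_b) : 0 <= c ->
  completely_positive E -> completely_positive (fun X => c *: E X).
Proof.
move=> c0 [lE Ep]; split=> [k X Y|k X Xp].
  by rewrite lE scalerDr !scalerA mulrC.
rewrite (_ : ampliation _ _ = c *: ampliation E X); first exact/psdZ/Ep.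
apply: tblockP => i j; rewrite tblock_ampliation -tblock_ampliation.
by apply/matrixP=> p q; rewrite !mxE.
Qed.

(** This is X -> tr_1((N (x) 1) X), the unnormalized state of the second factor after the outcome
    with effect N on the first; N = 1 gives the usual partial trace. *)
Definition partial_trace a b (N : 'M[C]_a) (X : 'M[C]_(a * b)) : 'M[C]_b :=
  \sum_i \sum_j N j i *: tblock X i j.

Lemma partial_trace_tens a b (N Y : 'M[C]_a) (Z : 'M[C]_b) :
  partial_trace N (Y *t Z) = \tr (N *m Y) *: Z.
Proof.
rewrite /partial_trace /mxtrace scaler_suml exchange_big /=; apply: eq_bigr => j _.
rewrite mxE scaler_suml; apply: eq_bigr => i _.
by rewrite tblock_tens scalerA.
Qed.

Lemma partial_trace_sum a b (I : Type) (s : seq I) (N : I -> 'M[C]_a)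
    (X : 'M[C]_(a * b)) :
  partial_trace (\sum_(t <- s) N t) X = \sum_(t <- s) partial_trace (N t) X.
Proof.
rewrite /partial_trace [RHS]exchange_big /=; apply: eq_bigr => i _.
rewrite [RHS]exchange_big /=; apply: eq_bigr => j _.
by rewrite summxE scaler_suml.
Qed.

Lemma trace_partial_trace1 a b (X : 'M[C]_(a * b)) :
  \tr (partial_trace 1%:M X) = \tr X.
Proof.
rewrite [RHS]/mxtrace sum_tidx /partial_trace linear_sum /=.
apply: eq_bigr => i _; rewrite (bigD1 i) //= big1 ?addr0; last first.
  by move=> j /negPf ji; rewrite mxE ji scale0r.
by rewrite mxE eqxx scale1r; apply: eq_bigr => p _; rewrite mxE.
Qed.

(** Writing N = B^* B exhibits the Kraus operators K_l = <l|B (x) 1. *)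
Lemma cp_partial_trace a b (N : 'M[C]_a) : psd N ->
  completely_positive (@partial_trace a b N).
Proof.
move=> /psd_gram [B ->].
pose K l : 'M[C]_(b, a * b) := \matrix_(p, k)
  (B l (mxtens.mxtens_unindex k).1 * (p == (mxtens.mxtens_unindex k).2)%:R).
have KiE l p i q : K l p (tidx (i, q)) = B l i * (p == q)%:R.
  by rewrite mxE mxtens.mxtens_indexK.
have KE X : partial_trace (B^t* *m B) X = \sum_l K l *m X *m (K l)^t*.
  apply/matrixP=> p q; rewrite !summxE.
  transitivity (\sum_i \sum_j \sum_l
      B l i * X (tidx (i, p)) (tidx (j, q)) * (B l j)^*%R).
    apply: eq_bigr => i _; rewrite summxE; apply: eq_bigr => j _.
    rewrite mxE [X in _ * X]mxE mxE mulr_suml; apply: eq_bigr => l _.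
    by rewrite adjE -[LHS]mulrA; exact: mulrC.
  rewrite exchange_big /= (eq_bigr _ (fun j _ => exchange_big _ _ _ _ _ _)).
  rewrite exchange_big /=; apply: eq_bigr => l _.
  rewrite [RHS]mxE sum_tidx; apply: eq_bigr => j _.
  rewrite (bigD1 q) //= [X in _ + X]big1 ?addr0; last first.
    by move=> m /negPf mq; rewrite adjE KiE eq_sym mq mulr0 conjC0 mulr0.
  rewrite adjE KiE eqxx mulr1.
  rewrite -mulr_suml; congr (_ * _).
  rewrite [RHS]mxE sum_tidx; apply: eq_bigr => i _.
  rewrite (bigD1 p) //= [X in _ + X]big1 ?addr0; last first.
    by move=> m /negPf mq; rewrite KiE eq_sym mq mulr0 mul0r.
  by rewrite KiE eqxx mulr1.
have -> : @partial_trace a b (B^t* *m B) = fun X => \sum_l K l *m X *m (K l)^t*.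
  by apply/boolp.funext.
by apply: cp_sum => l; exact: cp_kraus.
Qed.

Lemma channelP a b (E : 'M[C]_a -> 'M[C]_b) :
  is_channel E <-> completely_positive E /\ forall X, \tr (E X) = \tr X.
Proof. by split=> [[lE Ep tE] | [[lE Ep] tE]]; split. Qed.

Lemma channel_state a b (E : 'M[C]_a -> 'M[C]_b) X :
  is_channel E -> is_state X -> is_state (E X).
Proof.
by move=> /channelP [cE tE] [Xp tX]; split; [exact: cp_positive | rewrite tE].
Qed.

Lemma channel_trace_norm a b (E : 'M[C]_a -> 'M[C]_b) X : is_channel E ->
  X^t* = X -> trace_norm (E X) <= trace_norm X.
Proof.
move=> /channelP [cE tE] /trace_norm_jordan [P [N [Pp Np XE TE]]].
have -> : E X = E P - E N by case: cE => lE _; rewrite XE linear_funB.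
rewrite -lecR.
apply: le_trans (trace_norm_le (cp_positive cE Pp) (cp_positive cE Np)) _.
by rewrite !tE TE.
Qed.

Lemma channel_comp a b c (F : 'M[C]_b -> 'M[C]_c) (E : 'M[C]_a -> 'M[C]_b) :
  is_channel F -> is_channel E -> is_channel (fun X => F (E X)).
Proof.
move=> /channelP [cF tF] /channelP [cE tE]; apply/channelP.
by split=> [|X]; [exact: cp_comp | rewrite tF tE].
Qed.

Lemma channel_conj a (V : 'M[C]_a) : V \is unitarymx ->
  is_channel (fun X => V *m X *m V^t*).
Proof.
move=> Vu; apply/channelP; split=> [|X]; first exact: cp_kraus.
exact: trace_conj_unitary.
Qed.

Lemma channel_id a : is_channel (fun X : 'M[C]_a => X).
Proof.
apply/channelP; split=> //; have -> : (fun X : 'M[C]_a => X) =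
    (fun X => 1%:M *m X *m 1%:M^t*).
  by apply/boolp.funext=> X; rewrite adj1 mul1mx mulmx1.
exact: cp_kraus.
Qed.

Lemma channel_castmx a b (e : a = b) :
  is_channel (fun X : 'M[C]_a => castmx (e, e) X).
Proof.
case: _ / e; have -> : (fun X : 'M[C]_a => castmx (erefl, erefl) X) = id.
  by apply/boolp.funext=> X; rewrite castmx_id.
exact: channel_id.
Qed.

(** The first factor is measured, and the outcome selects the channel applied to the second. *)
Lemma channel_measure a b c (I : finType) (N : I -> 'M[C]_a)
    (E : I -> 'M[C]_b -> 'M[C]_c) :
  (forall x, psd (N x)) -> \sum_x N x = 1%:M -> (forall x, is_channel (E x)) ->
  is_channel (fun X : 'M[C]_(a * b) => \sum_x E x (partial_trace (N x) X)).
Proof.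
move=> Np N1 /(_ _)/channelP Ec; apply/channelP; split.
  apply: cp_sum => x; have [cE _] := Ec x.
  exact: (cp_comp cE (cp_partial_trace _ (Np x))).
move=> X; rewrite -[RHS]trace_partial_trace1 -N1 partial_trace_sum !linear_sum /=.
by apply: eq_bigr => x _; have [_ ->] := Ec x.
Qed.

Lemma channel_discard a b : is_channel (@partial_trace a b 1%:M).
Proof.
apply/channelP; split; last exact: trace_partial_trace1.
exact/cp_partial_trace/psd1.
Qed.

Lemma channel_average a b (I : finType) (E : I -> 'M[C]_a -> 'M[C]_b) :
  (0 < #|I|)%N -> (forall x, is_channel (E x)) ->
  is_channel (fun X => (#|I|%:R)^-1 *: \sum_x E x X).
Proof.
move=> I0 /(_ _)/channelP Ec; apply/channelP; split.
  apply: cp_scale; first by rewrite invr_ge0 ler0n.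
  by apply: cp_sum => x; have [] := Ec x.
move=> X; rewrite linearZ linear_sum /= (eq_bigr (fun=> \tr X)); last first.
  by move=> x _; have [_ ->] := Ec x.
by rewrite sumr_const -[X in _ * X]mulr_natl mulKf // pnatr_eq0 -lt0n.
Qed.

Lemma channel_trace a : is_channel (fun X : 'M[C]_a => (\tr X)%:M : 'M[C]_1).
Proof.
apply/channelP; split=> [|X]; last by rewrite mxtrace_scalar mulr1n.
have -> : (fun X : 'M[C]_a => (\tr X)%:M : 'M[C]_1) =
    (fun X => \sum_i (delta_mx 0 i : 'rV[C]_a) *m X *m (delta_mx 0 i)^t*).
  apply/boolp.funext=> X; apply/matrixP=> p q; rewrite !ord1 summxE mxE eqxx mulr1n.
  apply: eq_bigr => i _; rewrite -rowE trmx_delta map_delta_mx -colE.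
  by rewrite !mxE.
by apply: cp_sum => i; exact: cp_kraus.
Qed.

End Channels.

(** * Tensor powers, Gibbs states and twirling *)

Section TensorPowers.
Variable R : realType.
Local Notation C := R[i].

(* Lets d ^ (k + l) and d ^ k * d ^ l be identified without carrying the
   equality proofs of castmx through the rewriting. *)
Definition cast_eq m m' (M : 'M[C]_m) (N : 'M[C]_m') : Prop :=
  exists e : m = m', castmx (e, e) M = N.

Lemma cast_eq_refl m (M : 'M[C]_m) : cast_eq M M.
Proof. by exists erefl; rewrite castmx_id. Qed.

Lemma cast_eq_sym m m' (M : 'M[C]_m) (N : 'M[C]_m') :
  cast_eq M N -> cast_eq N M.
Proof.
by case=> e <-; case: _ / e; rewrite castmx_id; exact: cast_eq_refl.
Qed.

Lemma cast_eq_trans m m' m'' (M : 'M[C]_m) (N : 'M[C]_m') (P : 'M[C]_m'') :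
  cast_eq M N -> cast_eq N P -> cast_eq M P.
Proof.
by move=> [e <-]; case: _ / e; rewrite castmx_id.
Qed.

Lemma cast_eq_tens m m' n n' (M : 'M[C]_m) (N : 'M[C]_m') (P : 'M[C]_n)
    (Q : 'M[C]_n') :
  cast_eq M N -> cast_eq P Q -> cast_eq (M *t P) (N *t Q).
Proof.
move=> [e <-] [f <-]; case: _ / e; case: _ / f.
by rewrite !castmx_id; exact: cast_eq_refl.
Qed.

Lemma cast_eqP m m' (e : m = m') (M : 'M[C]_m) (N : 'M[C]_m') :
  cast_eq M N -> castmx (e, e) M = N.
Proof. by move=> [f <-]; rewrite (eq_irrelevance f e). Qed.

Lemma tens_assoc a b c (A : 'M[C]_a) (B : 'M[C]_b) (D : 'M[C]_c) :
  cast_eq (A *t (B *t D)) ((A *t B) *t D).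
Proof.
exists (mulnA a b c); apply/matrixP=> i j; rewrite castmxE.
case: (mxtens.mxtens_indexP i) => i' i3; case: (mxtens.mxtens_indexP i') => i1 i2.
case: (mxtens.mxtens_indexP j) => j' j3; case: (mxtens.mxtens_indexP j') => j1 j2.
have cE (k1 : 'I_a) (k2 : 'I_b) (k3 : 'I_c) :
    cast_ord (esym (mulnA a b c)) (tidx (tidx (k1, k2), k3)) =
    tidx (k1, tidx (k2, k3)).
  by apply: val_inj; rewrite /= mulnDl -mulnA addnA.
by rewrite !cE !mxtens.tensmxE mulrA.
Qed.

Lemma tens1x_cast a (A : 'M[C]_a) : cast_eq ((1%:M : 'M_1) *t A) A.
Proof.
apply: cast_eq_sym; exists (esym (mul1n a)).
by rewrite (mxtens.tens_scalar_mx 1 A) scale1r.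
Qed.

Lemma tensx1_cast a (A : 'M[C]_a) : cast_eq (A *t (1%:M : 'M_1)) A.
Proof.
apply: cast_eq_sym; exists (esym (muln1 a)).
by rewrite (mxtens.tens_mx_scalar 1 A) scale1r.
Qed.

Lemma ntS_cast d (A : 'M[C]_d) n : cast_eq (nt A n.+1) (A *t nt A n).
Proof.
(* [nt A 1] is [A] itself and not its product with a 1 x 1 identity, so only n = 0 needs a cast. *)
case: n => [|n]; last exact: cast_eq_refl.
exact/cast_eq_sym/tensx1_cast.
Qed.

Lemma ntD_cast d (A : 'M[C]_d) k l :
  cast_eq (nt A (k + l)) (nt A k *t nt A l).
Proof.
elim: k => [|k IH]; first exact/cast_eq_sym/tens1x_cast.
apply: cast_eq_trans (ntS_cast A (k + l)) _.
apply: cast_eq_trans (cast_eq_tens (cast_eq_refl A) IH) _.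
apply: cast_eq_trans (tens_assoc _ _ _) _.
exact: cast_eq_tens (cast_eq_sym (ntS_cast A k)) (cast_eq_refl _).
Qed.

Lemma tensDl a b (A A' : 'M[C]_a) (B : 'M_b) : (A + A') *t B = A *t B + A' *t B.
Proof. by apply/matrixP=> i j; rewrite !mxE mulrDl. Qed.

Lemma tensZl a b c (A : 'M[C]_a) (B : 'M_b) : (c *: A) *t B = c *: (A *t B).
Proof. by apply/matrixP=> i j; rewrite !mxE mulrA. Qed.

Lemma tensZr a b c (A : 'M[C]_a) (B : 'M_b) : A *t (c *: B) = c *: (A *t B).
Proof. by apply/matrixP=> i j; rewrite !mxE mulrCA. Qed.

Lemma tens_sumr a b (A : 'M[C]_a) (I : Type) (s : seq I) (F : I -> 'M_b) :
  A *t (\sum_(x <- s) F x) = \sum_(x <- s) A *t F x.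
Proof.
by apply/matrixP=> i j; rewrite mxE !summxE mulr_sumr; apply: eq_bigr => k _; rewrite mxE.
Qed.

Lemma trace_tens a b (A : 'M[C]_a) (B : 'M_b) : \tr (A *t B) = \tr A * \tr B.
Proof.
rewrite /mxtrace sum_tidx mulr_suml; apply: eq_bigr => i _.
by rewrite mulr_sumr; apply: eq_bigr => j _; rewrite mxtens.tensmxE.
Qed.

Lemma ntM d (A B : 'M[C]_d) n : nt (A *m B) n = nt A n *m nt B n.
Proof.
elim: n => [|[|n] IH] //; first by rewrite !mxtens.ntensmx0 mul1mx.
by rewrite !mxtens.ntensmxSS mxtens.tensmx_mul IH.
Qed.

Lemma adj_nt d (A : 'M[C]_d) n : (nt A n)^t* = nt (A^t*) n.
Proof.
elim: n => [|[|n] IH] //; first by rewrite !mxtens.ntensmx0 adj1.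
by rewrite !mxtens.ntensmxSS adj_tens IH.
Qed.

Lemma trace_nt d (A : 'M[C]_d) n : \tr (nt A n) = (\tr A) ^+ n.
Proof.
elim: n => [|[|n] IH] //; first by rewrite mxtens.ntensmx0 mxtrace1.
by rewrite mxtens.ntensmxSS trace_tens IH -exprS.
Qed.

Lemma ntZ d c (A : 'M[C]_d) n : nt (c *: A) n = c ^+ n *: nt A n.
Proof.
elim: n => [|[|n] IH] //; first by rewrite scale1r.
by rewrite !mxtens.ntensmxSS tensZl IH tensZr scalerA -exprS.
Qed.

Lemma nt_psd d (A : 'M[C]_d) n : psd A -> psd (nt A n).
Proof.
move=> Ap; elim: n => [|[|n] IH]; [exact: psd1 | exact: Ap |].
exact: psd_tens Ap IH.
Qed.

Lemma nt_state d (A : 'M[C]_d) n : is_state A -> is_state (nt A n).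
Proof.
by move=> [Ap tA]; split; [exact: nt_psd | rewrite trace_nt tA expr1n].
Qed.

Lemma nt_unitary d (V : 'M[C]_d) n : V \is unitarymx -> nt V n \is unitarymx.
Proof.
move=> Vu; elim: n => [|[|n] IH]; last exact: unitary_tens Vu IH.
  by apply/unitarymxP; rewrite adj1 mulmx1.
exact: Vu.
Qed.

Lemma nt_conj d (V A : 'M[C]_d) n :
  nt (V *m A *m V^t*) n = nt V n *m nt A n *m (nt V n)^t*.
Proof. by rewrite !ntM adj_nt. Qed.

Lemma nt_rep (G : finGroupType) d (U : G -> 'M[C]_d) n :
  proj_unitary_rep U -> proj_unitary_rep (fun g => nt (U g) n).
Proof.
move=> [Uu UM]; split=> [g|g h]; first exact: nt_unitary.
have [w w1 E] := UM g h; exists (w ^+ n); first by rewrite normrX w1 expr1n.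
by rewrite -ntM E ntZ.
Qed.

End TensorPowers.

(** * Gibbs states: symmetry and multiplicativity *)

Section Gibbs.
Variable R : realType.
Local Notation C := R[i].

(** In an eigenbasis of H the matrix of U intertwines the spectrum with itself, so [intertwine_fun]
    applies. *)
Lemma comm_herm_fun (f : R -> R) d (U H : 'M[C]_d) : H^t* = H ->
  comm_mx U H -> comm_mx U (herm_fun f H).
Proof.
move=> Hh; have [P [Pu [a [HE ->]]]] := herm_spectral f Hh.
have PK := unitaryVK Pu; have KP := unitaryKV Pu.
rewrite /comm_mx HE; move: (P^t*) PK KP => Q PK KP UHE.
have : rdiag a *m (P *m U *m Q) = (P *m U *m Q) *m rdiag a.
  have := congr1 (fun M => P *m M *m Q) UHE.
  by rewrite !mulmxA KP mul1mx -[X in X = _ -> _]mulmxA KP mulmx1 => ->.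
move=> /(intertwine_fun f) /(congr1 (fun M => Q *m M *m P)).
rewrite !mulmxA PK mul1mx -[X in X = _ -> _]mulmxA PK mulmx1 => E.
exact: esym E.
Qed.

(** The product of the two eigenbases diagonalizes the sum with eigenvalues x_i + y_j, which the
    exponential turns into products. *)
Lemma herm_fun_exp_tens a b (X : 'M[C]_a) (Y : 'M[C]_b) : X^t* = X -> Y^t* = Y ->
  herm_fun (@expR R) (X *t 1%:M + 1%:M *t Y) =
  herm_fun (@expR R) X *t herm_fun (@expR R) Y.
Proof.
move=> /herm_diag [V [Vu [x ->]]] /herm_diag [W [Wu [y ->]]].
rewrite !herm_funE //.
pose z k := x (mxtens.mxtens_unindex k).1 + y (mxtens.mxtens_unindex k).2 :> R.
have -> : (V^t* *m rdiag x *m V) *t 1%:M + 1%:M *t (W^t* *m rdiag y *m W) =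
    (V *t W)^t* *m rdiag z *m (V *t W).
  have {1}<- := unitaryVK Wu; have {1}<- := unitaryVK Vu.
  have -> : W^t* *m W = W^t* *m 1%:M *m W by rewrite mulmx1.
  have -> : V^t* *m V = V^t* *m 1%:M *m V by rewrite mulmx1.
  rewrite -!mxtens.tensmx_mul -adj_tens -mulmxDl -mulmxDr.
  have -> // : rdiag x *t 1%:M + 1%:M *t rdiag y = rdiag z.
  apply/matrixP=> i j; case: (mxtens.mxtens_indexP i) => i1 i2.
  case: (mxtens.mxtens_indexP j) => j1 j2.
  rewrite mxE !mxtens.tensmxE !rdiagE /z mxtens.mxtens_indexK /=.
  rewrite (can_eq (@mxtens.mxtens_indexK _ _)) xpair_eqE !mxE.
  case: (i1 == j1); case: (i2 == j2);
    by rewrite ?mulr1n ?mulr0n ?mulr1 ?mul1r ?mulr0 ?mul0r ?addr0 ?rcD.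
rewrite herm_funE; last exact: unitary_tens.
rewrite -!mxtens.tensmx_mul adj_tens; congr (_ *m _ *m _).
apply/matrixP=> i j; case: (mxtens.mxtens_indexP i) => i1 i2.
case: (mxtens.mxtens_indexP j) => j1 j2.
rewrite mxtens.tensmxE !rdiagE /z mxtens.mxtens_indexK /=.
rewrite (can_eq (@mxtens.mxtens_indexK _ _)) xpair_eqE expRD rcM.
case: (i1 == j1); case: (i2 == j2);
  by rewrite ?mulr1n ?mulr0n ?mulr0 ?mul0r.
Qed.

Lemma tensfam1 d n : tensfam (fun=> 1%:M : 'M[C]_d) n = 1%:M.
Proof.
case: n => [|n] //=; elim: n => [|n IH] //=; by rewrite IH tens11.
Qed.

Lemma copies_ham1 d (H : 'M[C]_d) : copies_ham H 1 = H.
Proof. by rewrite /copies_ham big_ord1. Qed.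

Lemma copies_hamSS d (H : 'M[C]_d) n :
  copies_ham H n.+2 = H *t 1%:M + 1%:M *t copies_ham H n.+1.
Proof.
rewrite /copies_ham big_ord_recl tens_sumr; congr (_ + _).
by rewrite -(tensfam1 d n.+1).
Qed.

Lemma adj_copies_ham d (H : 'M[C]_d) n : H^t* = H ->
  (copies_ham H n)^t* = copies_ham H n.
Proof.
move=> Hh; elim: n => [|[|n] IH].
- by rewrite /copies_ham big_ord0 trmx0 map_mx0.
- by rewrite copies_ham1.
- by rewrite copies_hamSS adjD !adj_tens !adj1 IH Hh.
Qed.

Lemma adj_rZ d (c : R) (H : 'M[C]_d) : H^t* = H -> (c%:C *: H)^t* = c%:C *: H.
Proof. by move=> Hh; rewrite adjZ Hh conj_real. Qed.

(** Copies do not interact, so their Gibbs state is a product. Splitting the input copies and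
    discarding output copies is therefore compatible with Gibbs preservation. *)
Lemma gibbs_copies (beta : R) d (H : 'M[C]_d) n : H^t* = H ->
  gibbs beta (copies_ham H n) = nt (gibbs beta H) n.
Proof.
move=> Hh; rewrite /gibbs -rcN ntZ exprVn.
have -> : herm_fun (@expR R) ((- beta)%:C *: copies_ham H n) =
    nt (herm_fun (@expR R) ((- beta)%:C *: H)) n; last by rewrite trace_nt.
elim: n => [|[|n] IH]; last first.
- rewrite mxtens.ntensmxSS -IH copies_hamSS scalerDr -tensZl -tensZr.
  by rewrite herm_fun_exp_tens //; apply: adj_rZ => //;
    exact: (adj_copies_ham n.+1 Hh).
- by rewrite copies_ham1.
(* Zero copies: the Hamiltonian is 0 on a one-dimensional space, and its exponential is 1. *)
rewrite /copies_ham big_ord0 scaler0 mxtens.ntensmx0.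
have -> : 0 = (1%:M)^t* *m rdiag (fun=> 0) *m 1%:M :> 'M[C]_1.
  by rewrite rdiag_const raddf0 mulmx0 mul0mx.
rewrite herm_funE; last by apply/unitarymxP; rewrite adj1 mulmx1.
by rewrite adj1 mul1mx mulmx1 expR0 rdiag_const.
Qed.

Lemma gibbs_trace (beta : R) d (H : 'M[C]_d) : H^t* = H -> (0 < d)%N ->
  \tr (gibbs beta H) = 1.
Proof.
move=> Hh d0; rewrite /gibbs mxtraceZ mulVf //.
rewrite -rcN; have [V [Vu [a ->]]] := herm_diag (adj_rZ (- beta) Hh).
rewrite herm_funE // trace_conj_unitaryV // trace_rdiag.
rewrite (_ : 0 = 0%:C) // (inj_eq (@complexI R)) gt_eqF //.
case: d d0 a {H Hh V Vu} => // d _ a.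
by rewrite big_ord_recl ltr_pwDl ?expR_gt0 // sumr_ge0 // => i _; rewrite expR_ge0.
Qed.

Lemma gibbs_conj (beta : R) d (U H : 'M[C]_d) : H^t* = H ->
  U \is unitarymx -> comm_mx U H ->
  U *m gibbs beta H *m U^t* = gibbs beta H.
Proof.
move=> Hh Uu UH; have cU : comm_mx U (gibbs beta H).
  rewrite /comm_mx /gibbs -scalemxAr -scalemxAl.
  congr (_ *: _); apply: comm_herm_fun; first by rewrite -rcN adj_rZ.
  by rewrite /comm_mx -scalemxAr -scalemxAl UH.
by rewrite cU -mulmxA (unitaryKV Uu) mulmx1.
Qed.

End Gibbs.

(** * Averaging over the group *)

Section Twirl.
Variables (R : realType) (G : finGroupType).
Local Notation C := R[i].

(** The phase w of the projective representation meets its conjugate and cancels because |w| = 1, so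
    conjugation is a genuine action. *)
Lemma rep_conjM d (V : G -> 'M[C]_d) g h X : proj_unitary_rep V ->
  V (g * h)%g *m X *m (V (g * h)%g)^t* =
  V g *m (V h *m X *m (V h)^t*) *m (V g)^t*.
Proof.
move=> [Vu VM]; have [w w1 E] := VM g h.
have -> : V g *m (V h *m X *m (V h)^t*) *m (V g)^t* =
    (V g *m V h) *m X *m (V g *m V h)^t* by rewrite adjM !mulmxA.
rewrite E adjZ -!scalemxAl -scalemxAr scalerA.
by rewrite -normCK w1 expr1n scale1r.
Qed.

Lemma rep_conjVM d (V : G -> 'M[C]_d) g h X : proj_unitary_rep V ->
  (V (g * h)%g)^t* *m (V g *m X *m (V g)^t*) *m V (g * h)%g =
  (V h)^t* *m X *m V h.
Proof.
move=> Vr; have [Vu _] := Vr.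
set Y := V g *m _ *m _.
have YE : Y = V (g * h)%g *m ((V h)^t* *m X *m V h) *m (V (g * h)%g)^t*.
  rewrite (rep_conjM _ _ _ Vr) /Y; congr (_ *m _ *m _).
  rewrite !mulmxA (unitaryKV (Vu h)) mul1mx -mulmxA (unitaryKV (Vu h)).
  by rewrite mulmx1.
rewrite YE !mulmxA (unitaryVK (Vu _)) mul1mx -mulmxA (unitaryVK (Vu _)).
by rewrite mulmx1.
Qed.

Definition twirl a b (V : G -> 'M[C]_a) (V' : G -> 'M[C]_b)
    (F : 'M[C]_a -> 'M[C]_b) (X : 'M[C]_a) : 'M[C]_b :=
  #|G|%:R^-1 *: \sum_g V' g *m F ((V g)^t* *m X *m V g) *m (V' g)^t*.

Lemma card_group_type_gt0 : (0 < #|G|)%N.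
Proof. by apply/card_gt0P; exists 1%g. Qed.

Lemma twirl_covariant a b (V : G -> 'M[C]_a) (V' : G -> 'M[C]_b)
    (F : 'M[C]_a -> 'M[C]_b) : proj_unitary_rep V -> proj_unitary_rep V' ->
  covariant V V' (twirl V V' F).
Proof.
move=> Vr Vr' h X; rewrite /twirl -scalemxAr -scalemxAl; congr (_ *: _).
rewrite mulmx_sumr mulmx_suml.
(* Substituting h g for g cancels h in the argument of [F] and makes it act on the output
   instead. *)
rewrite (reindex_inj (mulgI h)) /=; apply: eq_bigr => g _.
by rewrite (rep_conjVM _ _ _ Vr) (rep_conjM _ _ _ Vr').
Qed.

Lemma twirl_channel a b (V : G -> 'M[C]_a) (V' : G -> 'M[C]_b)
    (F : 'M[C]_a -> 'M[C]_b) : proj_unitary_rep V -> proj_unitary_rep V' ->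
  is_channel F -> is_channel (twirl V V' F).
Proof.
move=> [Vu _] [Vu' _] Fc; apply: channel_average; first exact: card_group_type_gt0.
move=> g; apply: (channel_comp (channel_conj (Vu' g))).
have Wu : (V g)^t* \is unitarymx by rewrite trmxC_unitary.
by have := channel_comp Fc (channel_conj Wu); rewrite trmxCK.
Qed.

Lemma average_const d (X : 'M[C]_d) : (#|G|%:R^-1 : C) *: \sum_(g : G) X = X.
Proof.
rewrite sumr_const -(scaler_nat #|G| X) scalerA mulVf ?scale1r //.
by rewrite pnatr_eq0 -lt0n; exact: card_group_type_gt0.
Qed.

End Twirl.

(** * State discrimination *)

Section BinomialMean.
Variable R : realType.
Implicit Types (p : R) (f g : nat -> R).

(** Conditioning on the first trial replaces the sum with binomial coefficients, so that the
    recursion runs parallel to that of [binom_op]. *)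
Fixpoint binom_mean p k f : R :=
  if k is k'.+1 then
    p * binom_mean p k' (fun j => f j.+1) + (1 - p) * binom_mean p k' f
  else f 0%N.

Lemma eq_binom_mean p k f g : f =1 g -> binom_mean p k f = binom_mean p k g.
Proof.
elim: k f g => [|k IH] f g fg /=; first exact: fg.
by rewrite (IH _ _ fg) (IH _ (fun j => g j.+1)) // => j; exact: fg.
Qed.

Lemma le_binom_mean p k f g : 0 <= p <= 1 -> (forall j, f j <= g j) ->
  binom_mean p k f <= binom_mean p k g.
Proof.
move=> /andP[p0 p1]; elim: k f g => [|k IH] f g fg /=; first exact: fg.
apply: lerD; first by apply: ler_wpM2l => //; apply: IH => j; exact: fg.
by apply: ler_wpM2l; [rewrite subr_ge0 | exact: IH].
Qed.

Lemma binom_meanZ p k c f :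
  binom_mean p k (fun j => c * f j) = c * binom_mean p k f.
Proof.
by elim: k f => [|k IH] f //=; rewrite !IH; ring.
Qed.

Lemma binom_mean_sum p k (I : Type) (s : seq I) (P : pred I) (f : I -> nat -> R) :
  \sum_(x <- s | P x) binom_mean p k (f x) =
  binom_mean p k (fun j => \sum_(x <- s | P x) f x j).
Proof.
elim: k f => [|k IH] f //=.
by rewrite big_split /= -!mulr_sumr !IH.
Qed.

(** Variance plus squared bias. The centre c is arbitrary because conditioning on a successful first
    trial moves it to c - 1. *)
Lemma binom_mean_sqr p k c :
  binom_mean p k (fun j => (j%:R - c) ^+ 2) =
  k%:R * (p * (1 - p)) + (k%:R * p - c) ^+ 2.
Proof.
elim: k c => [|k IH] c /=; first by rewrite mul0r !sub0r add0r mul0r sub0r.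
rewrite IH (eq_binom_mean _ _ (g := fun j => (j%:R - (c - 1)) ^+ 2)) ?IH.
  by rewrite -natr1; ring.
by move=> j; rewrite -natr1; congr (_ ^+ 2); ring.
Qed.

Lemma binom_mean_chebyshev p k (e : R) : 0 <= p <= 1 -> 0 < e -> (0 < k)%N ->
  binom_mean p k (fun j => (k%:R * e <= `|j%:R - k%:R * p|)%R%:R) <=
  e ^- 2 / k%:R.
Proof.
move=> p01 e0 k0; have kR : 0 < k%:R :> R by rewrite ltr0n.
have ke : 0 < k%:R * e by rewrite mulr_gt0.
(* Markov's inequality for the squared deviation: [g] dominates the indicator, and the variance k p
   (1 - p) is bounded by k. *)
pose g j : R := (k%:R * e) ^- 2 * (j%:R - k%:R * p) ^+ 2.
apply: (@le_trans _ _ (binom_mean p k g)).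
  apply: le_binom_mean => // j; rewrite /g; case: (lerP (k%:R * e)) => [h|_]; last first.
    by apply: mulr_ge0; rewrite ?invr_ge0 sqr_ge0.
  rewrite mulrC ler_pdivlMr ?exprn_gt0 //= mul1r -[leRHS]real_normK ?num_real //.
  by rewrite lerXn2r // ?nnegrE ?(ltW ke).
rewrite binom_meanZ binom_mean_sqr subrr expr0n addr0.
have -> : e ^- 2 / k%:R = (k%:R * e) ^- 2 * (k%:R * 1).
  by field; rewrite !gt_eqF.
apply: ler_wpM2l; first by rewrite invr_ge0 sqr_ge0.
apply: ler_wpM2l; first exact: ltW.
by case/andP: p01 => p0 p1; nra.
Qed.

End BinomialMean.

(** * Counting outcomes on k copies *)

Section BinomialOperator.
Variable R : realType.
Local Notation C := R[i].

Lemma castmx_mulmx m n (e : m = n) (X Y : 'M[C]_m) :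
  castmx (e, e) X *m castmx (e, e) Y = castmx (e, e) (X *m Y).
Proof. by case: _ / e; rewrite !castmx_id. Qed.

Lemma castmx_trace m n (e : m = n) (X : 'M[C]_m) : \tr (castmx (e, e) X) = \tr X.
Proof. by case: _ / e; rewrite castmx_id. Qed.

Lemma castmx_psd m n (e : m = n) (X : 'M[C]_m) : psd X -> psd (castmx (e, e) X).
Proof. by case: _ / e; rewrite castmx_id. Qed.

Lemma castmx_1 m n (e : m = n) : castmx (e, e) (1%:M : 'M[C]_m) = 1%:M.
Proof. by case: _ / e; rewrite castmx_id. Qed.

Lemma castmx_add m n (e : m = n) (X Y : 'M[C]_m) :
  castmx (e, e) (X + Y) = castmx (e, e) X + castmx (e, e) Y.
Proof. by case: _ / e; rewrite !castmx_id. Qed.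

Lemma castmx_opp m n (e : m = n) (X : 'M[C]_m) :
  castmx (e, e) (- X) = - castmx (e, e) X.
Proof. by case: _ / e; rewrite !castmx_id. Qed.

Lemma castmx_sum m n (e : m = n) (I : Type) (s : seq I) (F : I -> 'M[C]_m) :
  castmx (e, e) (\sum_(x <- s) F x) = \sum_(x <- s) castmx (e, e) (F x).
Proof.
case: _ / e; rewrite castmx_id; apply: eq_bigr => x _; by rewrite castmx_id.
Qed.

(* f(J), where J counts the outcomes "yes" when each of k copies is measured
   with the two-outcome measurement {A, 1 - A}. *)
Fixpoint binom_op d (A : 'M[C]_d) k (f : nat -> R) : 'M[C]_(d ^ k) :=
  if k is k'.+1 return 'M[C]_(d ^ k) then
    castmx (esym (expnS d k'), esym (expnS d k'))
      (A *t binom_op A k' (fun j => f j.+1) + (1%:M - A) *t binom_op A k' f)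
  else ((f 0%N)%:C)%:M.

Lemma binom_op_psd d (A : 'M[C]_d) k f : psd A -> psd (1%:M - A) ->
  (forall j, 0 <= f j) -> psd (binom_op A k f).
Proof.
move=> Ap Bp; elim: k f => [|k IH] f f0 /=.
  by rewrite -scalemx1; apply: psdZ; [rewrite ler0c | exact: psd1].
by apply: castmx_psd; apply: psdD; apply: psd_tens => //; apply: IH.
Qed.

Lemma binom_op_sum d (A : 'M[C]_d) k (I : Type) (s : seq I) (f : I -> nat -> R) :
  \sum_(x <- s) binom_op A k (f x) = binom_op A k (fun j => \sum_(x <- s) f x j).
Proof.
elim: k f => [|k IH] f /=.
  by rewrite !rmorph_sum /=.
by rewrite -castmx_sum big_split /= -!tens_sumr (IH (fun x j => f x j.+1)) IH.
Qed.

Lemma binom_op1 d (A : 'M[C]_d) k : binom_op A k (fun=> 1) = 1%:M.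
Proof.
elim: k => [|k IH] //=.
by rewrite IH -tensDl addrC subrK tens11 castmx_1.
Qed.

(** On a product state the outcomes are independent trials with success probability p, so the two
    recursions agree. *)
Lemma binom_op_trace d (A rho : 'M[C]_d) p k f : \tr rho = 1 ->
  \tr (A *m rho) = p%:C ->
  \tr (binom_op A k f *m nt rho k) = (binom_mean p k f)%:C.
Proof.
move=> t1 tA; elim: k f => [|k IH] f /=.
  by rewrite mxtens.ntensmx0 mulmx1 mxtrace_scalar mulr1n.
rewrite -(cast_eqP (esym (expnS d k)) (cast_eq_sym (ntS_cast rho k))).
rewrite castmx_mulmx castmx_trace mulmxDl mxtraceD !mxtens.tensmx_mul !trace_tens.
by rewrite !IH mulmxBl mul1mx linearB /= t1 tA rcD !rcM rcB.
Qed.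

End BinomialOperator.

(** * Separating finitely many states *)

Section Discrimination.
Variable R : realType.
Local Notation C := R[i].

Lemma trace_gram_eq0 m n (B : 'M[C]_(m, n)) : \tr (B^t* *m B) = 0 -> B = 0.
Proof.
move=> /eqP; rewrite /mxtrace psumr_eq0; last first.
  by move=> i _; apply: psd_diag_ge0; exact: gram_psd.
move=> /allP B0; apply/matrixP=> j i.
have := B0 i (mem_index_enum _); rewrite /= mxE psumr_eq0; last first.
  by move=> l _; rewrite adjE mulrC mul_conjC_ge0.
move=> /allP/(_ j (mem_index_enum _)) /=.
by rewrite adjE mulrC mul_conjC_eq0 mxE => /eqP.
Qed.

Lemma real_notin (s : seq C) : exists t : R, t%:C \notin s.
Proof.
(* This exceeds the real part of every element of [s] by at least 1. *)
exists (1 + \sum_(z <- s) `|complex.Re z|); apply/negP => zs.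
have : `|complex.Re (1 + \sum_(z <- s) `|complex.Re z|)%:C| <=
    \sum_(z <- s) `|complex.Re z|.
  rewrite [leRHS](big_rem _ zs) /= ler_wpDr //.
  by apply: sumr_ge0.
rewrite /= ger0_norm ?gerDr ?ler10 //.
by rewrite addr_ge0 // sumr_ge0.
Qed.

(** The observable A of the tail is perturbed to A + t D. For each E the value tr(A E) + t tr(D E)
    is affine in t and not identically zero, by tr(D D) != 0 for the head and tr(A E) != 0 for the
    tail, so each E excludes at most one t. *)
Lemma separating_observable_seq d (s : seq 'M[C]_d) :
  (forall D, D \in s -> D^t* = D /\ D != 0) ->
  exists A : 'M_d, A^t* = A /\ forall D, D \in s -> \tr (A *m D) != 0.
Proof.
elim: s => [|D s IH] sP.
  by exists 0; split=> //; rewrite trmx0 map_mx0.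
have [|A [Ah As]] := IH; first by move=> E Es; apply: sP; rewrite inE Es orbT.
have [Dh D0] := sP D (mem_head _ _).
have DD0 : \tr (D *m D) != 0.
  by apply: contraNneq D0 => DD; apply/eqP/trace_gram_eq0; rewrite Dh.
(* The roots of these affine functions. Where tr(D E) = 0 the quotient is 0, a harmless extra
   exclusion. *)
have [t ts] := real_notin [seq - \tr (A *m E) / \tr (D *m E) | E <- D :: s].
exists (A + t%:C *: D); split; first by rewrite adjD adj_rZ // Ah.
move=> E Es; rewrite mulmxDl -scalemxAl mxtraceD mxtraceZ.
apply/negP => /eqP tE.
have [DE0|DE0] := eqVneq (\tr (D *m E)) 0.
  have := Es; rewrite inE => /orP[/eqP ED|/As].
    by move: DE0 DD0; rewrite ED => ->; rewrite eqxx.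
  by rewrite -tE DE0 mulr0 addr0 eqxx.
move/negP: ts; apply; apply/mapP; exists E => //.
apply: (mulIf DE0); rewrite divfK //.
by apply/eqP; rewrite -addr_eq0 addrC tE.
Qed.

(** A separating observable is shifted and rescaled into [0, 1]. All states have trace 1, so the
    shift changes all expectations alike and the separation survives. *)
Lemma separating_effect (I : finType) d (r : I -> 'M[C]_d) :
  (forall x, is_state (r x)) ->
  exists (A : 'M_d) (p : I -> R), [/\ psd A, psd (1%:M - A),
    forall x, 0 <= p x <= 1, forall x, \tr (A *m r x) = (p x)%:C &
    forall x y, p x = p y -> r x = r y].
Proof.
move=> rs.
(* Zero differences are dropped: distinct indices may carry the same state. *)
pose s := [seq D <- [seq r xy.1 - r xy.2 | xy <- enum {: I * I}] | D != 0].
have [|A0 [Ah As]] := @separating_observable_seq d s.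
  move=> D; rewrite mem_filter => /andP[D0 /mapP[[x y] _ DE]]; split=> //.
  by rewrite DE adjB (psd_herm (proj1 (rs x))) (psd_herm (proj1 (rs y))).
have [c c0 [cm cp]] := herm_bound Ah.
have c2 : 0 < (2 * c)^-1 by rewrite invr_gt0 mulr_gt0.
have c2C : 0 <= ((2 * c)^-1)%:C :> C by rewrite ler0c ltW.
pose A := ((2 * c)^-1)%:C *: ((c%:C)%:M + A0).
have BE : 1%:M - A = ((2 * c)^-1)%:C *: ((c%:C)%:M - A0).
  apply/eqP; rewrite subr_eq /A -scalerDr addrACA addNr addr0 -raddfD /=.
  rewrite -rcD scale_scalar_mx -rcM.
  have -> : (2 * c)^-1 * (c + c) = 1 by field; rewrite gt_eqF.
  by [].
have Ap : psd A := psdZ c2C cp.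
have Bp : psd (1%:M - A) by rewrite BE; exact: (psdZ c2C cm).
have tr_r x : 0 <= \tr (A *m r x) by have [rp _] := rs x; exact: psd_trM_ge0.
pose p x := complex.Re (\tr (A *m r x)).
have pE x : \tr (A *m r x) = (p x)%:C by apply/esym/RRe_real/ger0_real.
exists A, p; split=> //.
  move=> x; rewrite -ler0c -pE tr_r /=.
  have [rp r1] := rs x; have := psd_trM_ge0 Bp rp.
  by rewrite mulmxBl mul1mx linearB /= r1 pE subr_ge0 lecR.
move=> x y pxy; apply/eqP; rewrite -subr_eq0; apply: contraT => D0.
have Ds : r x - r y \in s.
  by rewrite mem_filter D0; apply/mapP; exists (x, y) => //; rewrite mem_enum.
have /eqP[] := As _ Ds.
have : \tr (A *m (r x - r y)) = 0 by rewrite mulmxBr linearB /= !pE pxy subrr.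
rewrite /A -scalemxAl mxtraceZ => /eqP; rewrite mulf_eq0.
rewrite (inj_eq (@complexI R) _ 0) gt_eqF //= => /eqP.
rewrite mulmxDl mxtraceD mul_scalar_mx mxtraceZ linearB /=.
by have [_ ->] := rs x; have [_ ->] := rs y; rewrite subrr mulr0 add0r.
Qed.

(** Inversion sends 0 to 0, so all summands are harmless, and each nonzero f x has (f x)^-1 below 1
    plus the sum. *)
Lemma finite_gap (I : finType) (f : I -> R) : (forall x, 0 <= f x) ->
  exists2 e, 0 < e & forall x, f x != 0 -> e <= f x.
Proof.
move=> f0; have s0 : 0 <= \sum_x (f x)^-1.
  by apply: sumr_ge0 => x _; rewrite invr_ge0.
exists (1 + \sum_x (f x)^-1)^-1; first by rewrite invr_gt0 ltr_pwDl.
move=> x fx; have fx0 : 0 < f x by rewrite lt_neqAle eq_sym fx f0.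
rewrite -[leRHS]invrK lef_pV2 ?posrE ?invr_gt0 // ?ltr_pwDl //.
rewrite (bigD1 x) //= addrCA ler_wpDr // addr_ge0 // sumr_ge0 // => y _.
by rewrite invr_ge0.
Qed.

(** The separating effect is measured on k copies, and an index whose probability fits the observed
    frequency is guessed. A wrong state forces a deviation of at least half the gap, which
    Chebyshev's inequality controls uniformly in h. Errors are counted on states and not on indices,
    as [r] need not be injective. *)
Lemma state_discrimination (I : finType) (x0 : I) d (r : I -> 'M[C]_d) :
  (forall x, is_state (r x)) ->
  exists c : R, forall k, exists N : I -> 'M[C]_(d ^ k),
    [/\ forall x, psd (N x), \sum_x N x = 1%:M &
    forall h, exists q : I -> R,
      [/\ forall x, 0 <= q x, forall x, \tr (N x *m nt (r h) k) = (q x)%:C &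
          (0 < k)%N -> \sum_(x | r x != r h) q x <= c / k%:R]].
Proof.
move=> rs; have [A [p [Ap Bp p01 pE p_inj]]] := separating_effect rs.
have [] := @finite_gap (I * I)%type (fun xy => `|p xy.1 - p xy.2|).
  by move=> x; exact: normr_ge0.
move=> e2 e2_gt0 gap; pose e := e2 / 2.
have e0 : 0 < e by rewrite divr_gt0.
exists (e ^- 2) => k.
pose close (j : nat) x := `|j%:R - k%:R * p x| < k%:R * e.
(* The default [x0] makes the guess total, so that the effects sum to 1. *)
pose guess j := odflt x0 [pick x | close j x].
exists (fun x => binom_op A k (fun j => (guess j == x)%:R)); split.
- by move=> x; apply: binom_op_psd => // j; exact: ler0n.
- rewrite binom_op_sum -[RHS](binom_op1 A k); congr binom_op.
  apply/boolp.funext=> j; rewrite (bigD1 (guess j)) //= eqxx big1 ?addr0 //.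
  by move=> x /negPf; rewrite eq_sym => ->.
move=> h; exists (fun x => binom_mean (p h) k (fun j => (guess j == x)%:R)); split.
- move=> x; have <- : binom_mean (p h) k (fun=> 0) = 0 :> R.
    by rewrite -[RHS](mul0r (binom_mean (p h) k (fun=> 0))) -binom_meanZ;
      apply: eq_binom_mean => j; rewrite mul0r.
  by apply: le_binom_mean => // j; exact: ler0n.
- by move=> x; apply: binom_op_trace; [have [] := rs h | exact: pE].
move=> k0; have kR : 0 < k%:R :> R by rewrite ltr0n.
rewrite binom_mean_sum; apply: le_trans (binom_mean_chebyshev (p01 h) e0 k0).
apply: le_binom_mean => // j.
(* Summed over all wrong x, the indicators of the guess amount to the indicator that the guess is
   wrong. *)
apply: (@le_trans _ _ (r (guess j) != r h)%:R).
  have [rg|rg] := boolP (r (guess j) != r h).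
    rewrite (bigD1 (guess j)) //= eqxx big1 ?addr0 //.
    by move=> x /andP[_ /negPf]; rewrite eq_sym => ->.
  rewrite big1 // => x xh; case: eqP => // gx; rewrite gx in rg.
  by rewrite xh in rg.
rewrite ler_nat; case: (lerP (k%:R * e) _) => [_|hj]; first by case: (_ != _).
rewrite leqn0 eqb0 negbK; apply/eqP/p_inj.
(* The index h is close, so the guess is found and is close too; two close indices have
   probabilities less than 2 e = [e2] apart, against the gap. *)
have gj : close j (guess j).
  by rewrite /guess; case: pickP => [x //|/(_ h)]; rewrite /close hj.
apply/eqP; rewrite -subr_eq0; apply: contraT => pgh.
have := gap (guess j, h); rewrite /= normr_eq0 pgh => /(_ isT) egap.
have : k%:R * e2 <= k%:R * `|p (guess j) - p h| by rewrite ler_pM2l.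
have -> : k%:R * `|p (guess j) - p h| =
    `|(j%:R - k%:R * p h) - (j%:R - k%:R * p (guess j))|.
  by rewrite -[X in X * _](ger0_norm (ltW kR)) -normrM; congr `|_|; ring.
move=> /le_trans/(_ (ler_normB _ _)).
move: gj hj; rewrite /close /e; lra.
Qed.

End Discrimination.

(** * Covariant Gibbs-preserving channels *)

Section CovariantGibbsPreserving.
Variables (R : realType) (G : finGroupType) (d d' : nat) (beta : R).
Local Notation C := R[i].
Variables (rho H : 'M[C]_d) (sigma H' : 'M[C]_d').
Variables (U : G -> 'M[C]_d) (U' : G -> 'M[C]_d').
Hypotheses (rho_state : is_state rho) (sigma_state : is_state sigma).
Hypotheses (H_herm : H^t* = H) (H'_herm : H'^t* = H').
Hypotheses (U_rep : proj_unitary_rep U) (U'_rep : proj_unitary_rep U').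
Hypotheses (UH : forall g, comm_mx (U g) H) (U'H' : forall g, comm_mx (U' g) H').

Lemma state_dim_gt0 a (X : 'M[C]_a) : is_state X -> (0 < a)%N.
Proof.
case: a X => // X [_ /eqP].
by rewrite /mxtrace big_ord0 eq_sym oner_eq0.
Qed.

Lemma conj_unitaryK a (V X : 'M[C]_a) : V \is unitarymx ->
  V^t* *m (V *m X *m V^t*) *m V = X.
Proof.
by move=> Vu; rewrite !mulmxA (unitaryVK Vu) mul1mx -mulmxA (unitaryVK Vu) mulmx1.
Qed.

Lemma conj_unitaryVK a (V X : 'M[C]_a) : V \is unitarymx ->
  V *m (V^t* *m X *m V) *m V^t* = X.
Proof.
by move=> Vu; rewrite !mulmxA (unitaryKV Vu) mul1mx -mulmxA (unitaryKV Vu) mulmx1.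
Qed.

Lemma channel_conjV a (V : 'M[C]_a) : V \is unitarymx ->
  is_channel (fun X : 'M[C]_a => V^t* *m X *m V).
Proof.
move=> Vu; have Wu : V^t* \is unitarymx by rewrite trmxC_unitary.
by have := channel_conj Wu; rewrite trmxCK.
Qed.

Lemma trace_conj_swap a (V V' B X : 'M[C]_a) :
  \tr (V' *m B *m V *m X) = \tr (B *m (V *m X *m V')).
Proof. by rewrite -!mulmxA mxtrace_mulC !mulmxA. Qed.

Lemma trace_sub_sub a (B X Y Z : 'M[C]_a) :
  \tr (B *m (X - Z)) + \tr (- B *m (X - Y)) = \tr (B *m Y) - \tr (B *m Z).
Proof. by rewrite mulNmx linearN /= !mulmxBr !linearB /=; ring. Qed.

(** The trace is exact here, since zero output copies form a one-dimensional system. *)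
Lemma gibbs_trivial_channel n :
  exists E : 'M[C]_(d ^ n) -> 'M[C]_(d' ^ 0),
    [/\ is_channel E, @cov_GP_class R G beta d d' U U' H H' n 0 E &
        trace_norm (E (nt rho n) - nt sigma 0) = 0].
Proof.
exists (fun X => (\tr X)%:M); split.
- exact: (channel_trace R (d ^ n)).
- split=> [g X|].
    have Wu : nt (U g) n \is unitarymx by have [Uu _] := U_rep; exact: nt_unitary.
    rewrite (trace_conj_unitary _ Wu) !mxtens.ntensmx0.
    by rewrite mul1mx adj1 mulmx1.
  rewrite /GP_class /gibbs_preserving !gibbs_copies // mxtens.ntensmx0 trace_nt.
  by rewrite gibbs_trace // ?expr1n //; exact: state_dim_gt0 rho_state.
have [_ t1] := rho_state.
rewrite mxtens.ntensmx0 trace_nt t1 expr1n subrr.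
apply/eqP; rewrite eq_le trace_norm0 /=; apply: trace_norm_ge0.
by rewrite trmx0 map_mx0.
Qed.

(** * Converse: a symmetry of the input that the target lacks *)

Section Converse.
Variable g : G.
Hypotheses (g_rho : U g *m rho *m (U g)^t* = rho)
  (g_sigma : U' g *m sigma *m (U' g)^t* != sigma).

Lemma asymmetry_gap : exists2 e : R, 0 < e &
  forall n m (E : 'M[C]_(d ^ n) -> 'M[C]_(d' ^ m.+1)), is_channel E ->
    covariant (fun h => nt (U h) n) (fun h => nt (U' h) m.+1) E ->
    e <= trace_norm (E (nt rho n) - nt sigma m.+1).
Proof.
have [Uu _] := U_rep; have [U'u _] := U'_rep.
move: g_sigma; set sg := U' g *m _ *m _ => sg_neq.
pose B1 := sigma - sg.
have sh : sigma^t* = sigma by apply: psd_herm; have [] := sigma_state.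
have sgh : sg^t* = sg by rewrite /sg !adjM trmxCK sh mulmxA.
have B1h : B1^t* = B1 by rewrite adjB sh sgh.
have B10 : B1 != 0 by rewrite subr_eq0 eq_sym.
have tB_ge0 : 0 <= \tr (B1 *m B1).
  by rewrite -{1}B1h; exact/psd_tr_ge0/gram_psd.
have tB0 : \tr (B1 *m B1) != 0.
  by apply: contraNneq B10 => h; apply/eqP/trace_gram_eq0; rewrite B1h.
pose t := complex.Re (\tr (B1 *m B1)).
have tE : \tr (B1 *m B1) = t%:C by apply/esym/RRe_real/ger0_real.
have t0 : 0 < t.
  rewrite -ltcR; have -> : t%:C = \tr (B1 *m B1) by [].
  by rewrite lt_neqAle eq_sym tB0 tB_ge0.
have [c c0 [cm cp]] := herm_bound B1h.
exists (t / (2 * c)); first by rewrite divr_gt0 // mulr_gt0.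
move=> n m E Ec Ecov.
pose e := esym (expnS d' m).
pose B : 'M[C]_(d' ^ m.+1) := castmx (e, e) (B1 *t 1%:M).
have cE : ((c%:C)%:M : 'M[C]_(d' ^ m.+1)) = castmx (e, e) ((c%:C)%:M *t 1%:M).
  rewrite -[X in X *t _]scalemx1 tensZl tens11 scalemx1; move: e {B}.
  by move: (d' ^ m.+1)%N => z e; case: _ / e; rewrite castmx_id.
have Bm : psd ((c%:C)%:M - B).
  rewrite cE /B -castmx_opp -castmx_add (_ : _ - _ = ((c%:C)%:M - B1) *t 1%:M).
    exact/castmx_psd/(psd_tens cm)/psd1.
  by rewrite -[in RHS]scaleN1r tensDl tensZl scaleN1r.
have Bp : psd ((c%:C)%:M + B).
  rewrite cE /B -castmx_add -tensDl.
  exact/castmx_psd/(psd_tens cp)/psd1.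
set W := nt (U' g) m.+1; have Wu : W \is unitarymx by exact: nt_unitary.
set X := E _ - _.
have Es := channel_state Ec (nt_state n rho_state).
have Ss := nt_state m.+1 sigma_state.
have Xh : X^t* = X by rewrite adjB (psd_herm (proj1 Es)) (psd_herm (proj1 Ss)).
have WE : W *m E (nt rho n) *m W^t* = E (nt rho n).
  by rewrite -Ecov -nt_conj g_rho.
have trB Y : \tr (B *m nt Y m.+1) = \tr (B1 *m Y) * \tr (nt Y m).
  rewrite /B -(cast_eqP e (cast_eq_sym (ntS_cast Y m))).
  by rewrite castmx_mulmx castmx_trace mxtens.tensmx_mul trace_tens mul1mx.
have tr_s : \tr (nt sigma m) = 1.
  by have [_ s1] := sigma_state; rewrite trace_nt s1 expr1n.
have tr_sg : \tr (nt sg m) = 1.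
  rewrite trace_nt /sg trace_conj_unitary //.
  by have [_ ->] := sigma_state; rewrite expr1n.
(* This evaluates tr(B (W X W^* - X)), with W moved onto B by cyclicity. *)
have key : t%:C = \tr ((W^t* *m B *m W) *m X) + \tr (- B *m X).
  have -> : \tr ((W^t* *m B *m W) *m X) = \tr (B *m (W *m X *m W^t*)).
    exact: trace_conj_swap.
  have -> : W *m X *m W^t* = E (nt rho n) - nt sg m.+1.
    by rewrite /X mulmxBr mulmxBl WE -nt_conj.
  have BB : \tr (B1 *m B1) = \tr (B1 *m sigma) - \tr (B1 *m sg).
    by rewrite {2}/B1 mulmxBr linearB.
  by rewrite /X trace_sub_sub !trB tr_s tr_sg !mulr1 -BB -tE.
have Wb (Y : 'M[C]_(d' ^ m.+1)) : W^t* *m ((c%:C)%:M + Y) *m W =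
    (c%:C)%:M + W^t* *m Y *m W.
  by rewrite mulmxDr mulmxDl mul_mx_scalar -scalemxAl (unitaryVK Wu) scalemx1.
(* Conjugation and negation preserve the bounds -c and c on B, so each of the two traces is at most
   c times the norm of X. *)
rewrite ler_pdivrMr ?mulr_gt0 // -lecR key.
have -> : trace_norm X * (2 * c) = c * trace_norm X + c * trace_norm X by ring.
rewrite rcD; apply: lerD.
  apply: (trace_norm_test Xh); last by rewrite -Wb; exact: psd_conjV.
  have -> : W^t* *m B *m W = - (W^t* *m (- B) *m W).
    by rewrite mulmxN mulNmx opprK.
  by rewrite opprK -Wb; exact: psd_conjV.
by apply: (trace_norm_test Xh); rewrite ?opprK.
Qed.

End Converse.

(** * Achievability: estimate, decode and twirl *)

Section Achievability.
Hypothesis sym_sub : sym_group U rho \subset sym_group U' sigma.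

(** The orbits are indexed through x^-1; the adjoint is used because it agrees with [U x^-1] only up
    to a phase. *)
Let r x := (U x)^t* *m rho *m U x.
Let s x := (U' x)^t* *m sigma *m U' x.

(** Equality of [r x] and [r h] means that x h^-1 fixes rho, hence sigma by the inclusion of
    symmetry groups. *)
Lemma orbit_map x h : r x = r h -> s x = s h.
Proof.
move=> rxh; have [Uu _] := U_rep; have [U'u _] := U'_rep.
have xE : x = (x * h^-1 * h)%g by rewrite mulgKV.
have : (x * h^-1)%g \in sym_group U rho.
  rewrite inE; apply/eqP.
  rewrite -[X in _ *m X *m _](conj_unitaryVK rho (Uu h)) -/(r h).
  by rewrite -(rep_conjM _ _ _ U_rep) -xE -rxh conj_unitaryVK.
move=> /(fintype.subsetP sym_sub); rewrite inE => /eqP sE.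
have hs : U' h *m s h *m (U' h)^t* = sigma := conj_unitaryVK _ (U'u h).
have xs : U' x *m s h *m (U' x)^t* = sigma.
  by rewrite xE (rep_conjM _ _ _ U'_rep) hs sE.
by rewrite -[s h](conj_unitaryK _ (U'u x)) xs.
Qed.

(** * The decoder: k copies measured, l processed, j outputs discarded, m kept *)

Section Decoder.
Variables (k l j m : nat) (N : G -> 'M[C]_(d ^ k)).
Variable E : 'M[C]_(d ^ l) -> 'M[C]_(d' ^ (j + m)).
Hypotheses (N_psd : forall x, psd (N x)) (N1 : \sum_x N x = 1%:M).
Hypotheses (E_channel : is_channel E)
  (E_GP : E (nt (gibbs beta H) l) = nt (gibbs beta H') (j + m)).

Let discard (Y : 'M[C]_(d' ^ (j + m))) : 'M[C]_(d' ^ m) :=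
  partial_trace 1%:M (castmx (expnD d' j m, expnD d' j m) Y).

(* The action of the channel after the first k copies have been guessed to be
   in the state r x: the orbit element is moved back to rho before E, and the
   corresponding element of the orbit of sigma is produced after it. *)
Let branch x (Y : 'M[C]_(d ^ l)) : 'M[C]_(d' ^ m) :=
  (nt (U' x) m)^t* *m discard (E (nt (U x) l *m Y *m (nt (U x) l)^t*))
  *m nt (U' x) m.

Let decoder (X : 'M[C]_(d ^ (k + l))) : 'M[C]_(d' ^ m) :=
  \sum_x branch x (partial_trace (N x) (castmx (expnD d k l, expnD d k l) X)).

Lemma discard_nt (Y : 'M[C]_d') : \tr Y = 1 -> discard (nt Y (j + m)) = nt Y m.
Proof.
move=> Y1; rewrite /discard (cast_eqP _ (ntD_cast Y j m)) partial_trace_tens.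
by rewrite mul1mx trace_nt Y1 expr1n scale1r.
Qed.

Lemma discard_channel : is_channel discard.
Proof.
exact: (channel_comp (channel_discard R _ _) (channel_castmx R (expnD d' j m))).
Qed.

Lemma branch_channel x : is_channel (branch x).
Proof.
have [Uu _] := U_rep; have [U'u _] := U'_rep.
apply: (channel_comp (channel_conjV (nt_unitary m (U'u x)))).
apply: (channel_comp discard_channel); apply: (channel_comp E_channel).
exact: (channel_conj (nt_unitary l (Uu x))).
Qed.

Lemma decoder_channel : is_channel decoder.
Proof.
apply: (channel_comp (channel_measure N_psd N1 branch_channel)).
exact: channel_castmx.
Qed.

Lemma branch_linear x : linear (branch x).
Proof. exact: channel_linear (branch_channel x). Qed.

Lemma decoder_nt (Y : 'M[C]_d) :
  decoder (nt Y (k + l)) = \sum_x \tr (N x *m nt Y k) *: branch x (nt Y l).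
Proof.
rewrite /decoder (cast_eqP _ (ntD_cast Y k l)); apply: eq_bigr => x _.
by rewrite partial_trace_tens (linear_funZ _ _ (branch_linear x)).
Qed.

Lemma trace_measurement (Y : 'M[C]_d) : \tr Y = 1 ->
  \sum_x \tr (N x *m nt Y k) = 1.
Proof.
move=> Y1; rewrite -linear_sum /= -mulmx_suml N1 mul1mx trace_nt Y1.
by rewrite expr1n.
Qed.

Lemma gibbs_U x : U x *m gibbs beta H *m (U x)^t* = gibbs beta H.
Proof. by have [Uu _] := U_rep; exact: gibbs_conj. Qed.

Lemma gibbs_U' x : U' x *m gibbs beta H' *m (U' x)^t* = gibbs beta H'.
Proof. by have [U'u _] := U'_rep; exact: gibbs_conj. Qed.

(** Gibbs states are invariant under the group, so every branch outputs the Gibbs state, and only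
    the total probability 1 of the outcomes matters. *)
Lemma decoder_gibbs : decoder (nt (gibbs beta H) (k + l)) = nt (gibbs beta H') m.
Proof.
have [Uu _] := U_rep; have [U'u _] := U'_rep.
rewrite decoder_nt (eq_bigr (fun x =>
    \tr (N x *m nt (gibbs beta H) k) *: nt (gibbs beta H') m)).
  rewrite -scaler_suml trace_measurement ?scale1r //.
  by apply: gibbs_trace => //; exact: state_dim_gt0 rho_state.
move=> x _; congr (_ *: _); rewrite /branch -nt_conj gibbs_U E_GP discard_nt.
  rewrite -{1}(gibbs_U' x) nt_conj conj_unitaryK //; exact: nt_unitary.
by apply: gibbs_trace => //; exact: state_dim_gt0 sigma_state.
Qed.

Let F := twirl (fun g => nt (U g) (k + l)) (fun g => nt (U' g) m) decoder.

Lemma twirled_channel : is_channel F.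
Proof.
exact: (twirl_channel (nt_rep _ U_rep) (nt_rep _ U'_rep) decoder_channel).
Qed.

Lemma twirled_cov_GP : @cov_GP_class R G beta d d' U U' H H' (k + l) m F.
Proof.
have [Uu _] := U_rep.
split; first exact: (twirl_covariant _ (nt_rep _ U_rep) (nt_rep _ U'_rep)).
rewrite /GP_class /gibbs_preserving !gibbs_copies //.
rewrite /F /twirl (eq_bigr (fun=> nt (gibbs beta H') m)) ?average_const // => g _.
rewrite -{1}(gibbs_U g) nt_conj conj_unitaryK; last exact: nt_unitary.
by rewrite decoder_gibbs -nt_conj gibbs_U'.
Qed.

Let err := trace_norm (E (nt rho l) - nt sigma (j + m)).

Lemma adj_state a (X : 'M[C]_a) : is_state X -> X^t* = X.
Proof. by case=> /psd_herm. Qed.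

Lemma r_state x : is_state (r x).
Proof.
have [Uu _] := U_rep; have [rp r1] := rho_state.
by split; [exact: psd_conjV | rewrite trace_conj_unitaryV].
Qed.

Lemma s_state x : is_state (s x).
Proof.
have [U'u _] := U'_rep; have [sp s1] := sigma_state.
by split; [exact: psd_conjV | rewrite trace_conj_unitaryV].
Qed.

Lemma adj_sub_states a (X Y : 'M[C]_a) : is_state X -> is_state Y ->
  (X - Y)^t* = X - Y.
Proof. by move=> Xs Ys; rewrite adjB (adj_state Xs) (adj_state Ys). Qed.

Lemma err_ge0 : 0 <= err.
Proof.
apply/trace_norm_ge0/adj_sub_states; last exact: nt_state.
exact/(channel_state E_channel)/nt_state.
Qed.

Lemma nt_s x : nt (s x) m = (nt (U' x) m)^t* *m nt sigma m *m nt (U' x) m.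
Proof. by rewrite /s !ntM adj_nt. Qed.

(** Under a correct guess the rotation restores rho exactly and, by [orbit_map], the output rotation
    leads to [s h]. What remains is the error of [E], contracted by discarding and conjugation. *)
Lemma branch_err x h : r x = r h ->
  trace_norm (branch x (nt (r h) l) - nt (s h) m) <= err.
Proof.
move=> rxh; have [Uu _] := U_rep; have [U'u _] := U'_rep.
rewrite -(orbit_map rxh) nt_s /branch -nt_conj -rxh conj_unitaryVK //.
rewrite -mulmxBl -mulmxBr.
have [_ s1] := sigma_state; rewrite -(discard_nt s1).
have Es := channel_state E_channel (nt_state l rho_state).
have Ss := nt_state (j + m) sigma_state.
rewrite -(linear_funB _ _ (channel_linear discard_channel)).
have Xh := adj_sub_states Es Ss.
apply: le_trans (channel_trace_norm discard_channel Xh).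
apply: (channel_trace_norm (channel_conjV (nt_unitary m (U'u x)))).
rewrite (linear_funB _ _ (channel_linear discard_channel)).
by apply: adj_sub_states; exact: (channel_state discard_channel).
Qed.

(** The output is a mixture of the branches with weights [q x]: correct guesses cost at most [err],
    wrong ones at most 2, which bounds the distance of any two states. *)
Lemma decoder_err h (q : G -> R) :
  (forall x, 0 <= q x) -> (forall x, \tr (N x *m nt (r h) k) = (q x)%:C) ->
  trace_norm (decoder (nt (r h) (k + l)) - nt (s h) m) <=
  err + 2 * \sum_(x | r x != r h) q x.
Proof.
move=> q0 qE; have [_ r1] := r_state h.
have q1 : \sum_x q x = 1.
  apply: (@complexI R); rewrite rmorph_sum /=; transitivity (1 : C) => //.
  rewrite -(trace_measurement r1).
  by apply: eq_bigr => x _; rewrite qE.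
have bs x : is_state (branch x (nt (r h) l)).
  exact: channel_state (branch_channel x) (nt_state l (r_state h)).
have ss : is_state (nt (s h) m) by exact/nt_state/s_state.
have bh x := adj_sub_states (bs x) ss.
have -> : decoder (nt (r h) (k + l)) - nt (s h) m =
    \sum_x (q x)%:C *: (branch x (nt (r h) l) - nt (s h) m).
  rewrite decoder_nt (eq_bigr _ (fun x _ => scalerBr _ _ _)) sumrB -scaler_suml.
  rewrite -rmorph_sum q1 scale1r; congr (_ - _).
  by apply: eq_bigr => x _; rewrite qE.
have qh x : ((q x)%:C *: (branch x (nt (r h) l) - nt (s h) m))^t* =
    (q x)%:C *: (branch x (nt (r h) l) - nt (s h) m) by exact: adj_rZ.
apply: le_trans (trace_norm_sum _ qh) _.
rewrite mulr_sumr [X in _ + X]big_mkcond /= -[X in X + _]mul1r.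
rewrite -[X in X * err]q1 mulr_suml.
rewrite -big_split /=; apply: ler_sum => x _.
apply: le_trans (trace_normZ (q0 x) (bh x)) _.
case: (eqVneq (r x) (r h)) => [rxh|_].
  by rewrite addr0; apply: ler_wpM2l => //; exact: branch_err.
rewrite ler_wpDl ?mulr_ge0 ?err_ge0 // [leRHS]mulrC.
by apply: ler_wpM2l => //; exact: (trace_norm_states (bs x) ss).
Qed.

(** The error of the twirled map is the average of the rotated decoder errors over the orbit, so the
    decoder has to be good at every orbit element. *)
Lemma twirled_err e :
  (forall h, trace_norm (decoder (nt (r h) (k + l)) - nt (s h) m) <= e) ->
  trace_norm (F (nt rho (k + l)) - nt sigma m) <= e.
Proof.
move=> dec_e; have [Uu _] := U_rep; have [U'u _] := U'_rep.
pose D h := nt (U' h) m *m (decoder (nt (r h) (k + l)) - nt (s h) m) *m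
  (nt (U' h) m)^t*.
have dh h := adj_sub_states (channel_state decoder_channel
  (nt_state (k + l) (r_state h))) (nt_state m (s_state h)).
have Dh h : (D h)^t* = D h by rewrite /D !adjM trmxCK dh mulmxA.
have De h : trace_norm (D h) <= e.
  apply: le_trans (dec_e h).
  exact: (channel_trace_norm (channel_conj (nt_unitary m (U'u h))) (dh h)).
have -> : F (nt rho (k + l)) - nt sigma m =
    ((#|G|%:R^-1 : R)%:C) *: \sum_h D h.
  rewrite -[nt sigma m](average_const G) /F /twirl -scalerBr -sumrB.
  rewrite (_ : (_%:R^-1 : R)%:C = #|G|%:R^-1) ?fmorphV ?rmorph_nat //.
  congr (_ *: _); apply: eq_bigr => h _.
  have sE : nt (U' h) m *m nt (s h) m *m (nt (U' h) m)^t* = nt sigma m.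
    have hE : U' h *m s h *m (U' h)^t* = sigma := conj_unitaryVK _ (U'u h).
    by rewrite -nt_conj hE.
  have rE : (nt (U h) (k + l))^t* *m nt rho (k + l) *m nt (U h) (k + l) =
      nt (r h) (k + l).
    by rewrite /r !ntM adj_nt.
  by rewrite /D mulmxBr mulmxBl sE rE.
have G0 : 0 <= (#|G|%:R^-1 : R) by rewrite invr_ge0.
have sDh : (\sum_h D h)^t* = \sum_h D h.
  rewrite -[in RHS](eq_bigr _ (fun h _ => Dh h)).
  apply/matrixP=> a b; rewrite adjE !summxE rmorph_sum.
  by apply: eq_bigr => h _; rewrite adjE.
apply: le_trans (trace_normZ G0 sDh) _.
rewrite mulrC ler_pdivrMr ?ltr0n ?card_group_type_gt0 //.
apply: le_trans (trace_norm_sum _ Dh) _.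
apply: le_trans (ler_sum _ (fun h _ => De h)) _.
rewrite sumr_const mulr_natr; exact: lexx.
Qed.

End Decoder.

(** The sums n = k + l and M = j + m are equations between variables, so that truncated copy numbers
    can be inserted without casts. A channel is delivered even for k = 0, where no error bound is
    claimed. *)
Lemma cov_GP_approximation : exists c : R, forall n M k l j m
    (E : 'M[C]_(d ^ l) -> 'M[C]_(d' ^ M)),
  n = (k + l)%N -> M = (j + m)%N -> is_channel E ->
  GP_class beta H H' E ->
  exists F : 'M[C]_(d ^ n) -> 'M[C]_(d' ^ m),
    [/\ is_channel F, @cov_GP_class R G beta d d' U U' H H' n m F,
        0 <= trace_norm (F (nt rho n) - nt sigma m) &
        (0 < k)%N -> trace_norm (F (nt rho n) - nt sigma m) <=
          trace_norm (E (nt rho l) - nt sigma M) + c / k%:R].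
Proof.
have [c cP] := state_discrimination 1%g r_state.
(* The factor 2 is the cost of a wrong guess in [decoder_err]. *)
exists (2 * c) => n M k l j m E nE ME; subst n M => Ec.
rewrite /GP_class /gibbs_preserving !gibbs_copies // => EGP.
have [N [Np N1 Nq]] := cP k.
eexists; split.
- exact: (twirled_channel Np N1 Ec).
- exact: (twirled_cov_GP N1 Ec EGP).
- apply/trace_norm_ge0/adj_sub_states; last exact: nt_state.
  exact: (channel_state (twirled_channel Np N1 Ec)) (nt_state _ rho_state).
move=> k0; apply: (twirled_err Np N1 Ec) => h.
have [q [q0 qE qb]] := Nq h.
apply: le_trans (decoder_err N1 Ec q0 qE) _.
by rewrite lerD2l -mulrA ler_wpM2l // qb.
Qed.

End Achievability.

End CovariantGibbsPreserving.

(** * Rates *)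

Section Limits.
Variable R : realType.

Lemma cvg0_seqP (u : nat -> R) :
  u n @[n --> \oo] --> (0 : R) <->
  forall e, 0 < e -> exists N, forall n, (N <= n)%N -> `|u n| < e.
Proof.
split=> [/cvgrPdist_lt u0 e e0|uN].
  have [N _ NP] := u0 e e0; exists N => n /NP.
  by rewrite sub0r normrN.
apply/cvgrPdist_lt => e e0; have [N NP] := uN e e0.
by exists N => // n /NP; rewrite sub0r normrN.
Qed.

Lemma linear_unbounded (a b : R) : 0 < a ->
  exists N, forall n, (N <= n)%N -> b <= a * n%:R.
Proof.
move=> a0; exists (Num.truncn (b / a)).+1 => n Nn.
rewrite mulrC -ler_pdivrMr //; apply: le_trans (ltW (truncnS_gt _)) _.
by rewrite ler_nat.
Qed.

End Limits.

Section Rates.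
Variables (R : realType) (G : finGroupType) (d d' : nat) (beta : R).
Local Notation C := R[i].
Variables (rho H : 'M[C]_d) (sigma H' : 'M[C]_d').
Variables (U : G -> 'M[C]_d) (U' : G -> 'M[C]_d').
Hypotheses (rho_state : is_state rho) (sigma_state : is_state sigma).
Hypotheses (H_herm : H^t* = H) (H'_herm : H'^t* = H').
Hypotheses (U_rep : proj_unitary_rep U) (U'_rep : proj_unitary_rep U').
Hypotheses (UH : forall g, comm_mx (U g) H) (U'H' : forall g, comm_mx (U' g) H').

(** The membership condition of the set inside [rate], kept convertible to it. *)
Definition achievable
    (O : forall n m, ('M[C]_(d ^ n) -> 'M[C]_(d' ^ m)) -> Prop) (r : R) : Prop :=
  0 <= r /\
  let m n := Num.truncn (r * n%:R) in
  exists E : forall n, 'M[C]_(d ^ n) -> 'M[C]_(d' ^ m n),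
    (forall n, is_channel (E n) /\ O n (m n) (E n)) /\
    2^-1 * trace_norm (E n (nt rho n) - nt sigma (m n)) @[n --> \oo] --> (0 : R).

Let GP := @GP_class R beta d d' H H'.
Let covGP := @cov_GP_class R G beta d d' U U' H H'.

Lemma achievable_cov_GP r : achievable covGP r -> achievable GP r.
Proof.
move=> [r0 [E [EO E0]]]; split=> //; exists E; split=> // n.
by have [Ec [_ EGP]] := EO n.
Qed.

(** The supremum defining the covariant rate is thereby over a nonempty set and at least 0. *)
Lemma achievable_cov0 : achievable covGP 0.
Proof.
split=> //=.
have E n : exists E : 'M[C]_(d ^ n) -> 'M[C]_(d' ^ Num.truncn (0 * n%:R : R)),
    [/\ is_channel E, covGP E &
        trace_norm (E (nt rho n) - nt sigma (Num.truncn (0 * n%:R : R))) = 0].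
  rewrite mul0r truncn0.
  exact: (gibbs_trivial_channel beta sigma U' rho_state H_herm H'_herm U_rep).
exists (fun n => projT1 (boolp.cid (E n))); split.
  by move=> n; case: boolp.cid => F /= [].
apply/cvg0_seqP => e e0; exists 0%N => n _.
by case: boolp.cid => F /= [_ _ ->]; rewrite mulr0 normr0.
Qed.

Lemma achievable_GP_cov (r r' : R) : sym_group U rho \subset sym_group U' sigma ->
  achievable GP r -> 0 < r' < r -> achievable covGP r'.
Proof.
move=> sub [r_ge0 [E [EO /cvg0_seqP E0]]] /andP[r'0 r'r].
have r0 : 0 < r by exact: lt_trans r'r.
split; first exact: ltW.
have [c cP] := cov_GP_approximation beta rho_state sigma_state H_herm H'_herm
  U_rep U'_rep UH U'H' sub.
(* theta is the fraction of the input copies spent on estimating the group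
   element; the remaining ones still suffice for rate r'. *)
pose theta := 1 - r' / r.
have th0 : 0 < theta by rewrite subr_gt0 ltr_pdivrMr // mul1r.
have thE : 1 - theta = r' / r by rewrite /theta opprB addrC subrK.
have th1 : 0 < 1 - theta by rewrite thE divr_gt0.
pose k n := Num.truncn (theta * n%:R).
have k_le n : (k n)%:R <= theta * n%:R.
  by rewrite truncn_le mulr_ge0 // ltW.
have kn n : (k n <= n)%N.
  rewrite -(ler_nat R); apply: le_trans (k_le n) _.
  by rewrite -[leRHS]mul1r; apply: ler_wpM2r => //; lra.
have l_ge n : (1 - theta) * n%:R <= (n - k n)%:R.
  by rewrite natrB // mulrBl mul1r lerD2l lerN2.
pose m n := Num.truncn (r' * n%:R).
(* The unmeasured copies yield [M n] outputs; since r (1 - theta) = r', these are at least the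
   required [m n], and the surplus is discarded. *)
pose M n := Num.truncn (r * (n - k n)%:R).
have mM n : (m n <= M n)%N.
  apply: le_truncn; apply: (@le_trans _ _ (r * ((1 - theta) * n%:R))).
    by rewrite thE mulrA (mulrC r) divfK // gt_eqF.
  by apply: ler_wpM2l.
have FP n := cP n (M n) (k n) (n - k n)%N (M n - m n)%N (m n)
  (E (n - k n)%N) (esym (subnKC (kn n))) (esym (subnK (mM n)))
  (proj1 (EO _)) (proj2 (EO _)).
exists (fun n => projT1 (boolp.cid (FP n))); split.
  by move=> n; case: boolp.cid => F /= [].
apply/cvg0_seqP => e e0.
have [N1 N1P] := E0 (e / 2) (divr_gt0 e0 (ltr0n R 2)).
(* [Na] makes k n positive and c / k n smaller than e; [Nb] leaves at least [N1] copies for [E].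
   After the factor 1/2 each contribution is below e / 2. *)
have [Na NaP] := linear_unbounded (Num.truncn (`|c| / e)).+1%:R th0.
have [Nb NbP] := linear_unbounded N1%:R th1.
exists (maxn Na Nb) => n; rewrite geq_max => /andP[/NaP kK /NbP lN].
have kK' : ((Num.truncn (`|c| / e)).+1 <= k n)%N.
  by rewrite /k truncn_ge_nat // mulr_ge0 // ltW.
have /N1P E1 : (N1 <= n - k n)%N.
  by rewrite -(ler_nat R); apply: le_trans lN (l_ge n).
have k0 : (0 < k n)%N by exact: leq_trans kK'.
case: boolp.cid => F /= [_ _ F0 /(_ k0) Fle].
rewrite ger0_norm ?mulr_ge0 // ?invr_ge0 //.
have ck : c / (k n)%:R < e.
  rewrite ltr_pdivrMr ?ltr0n //; apply: le_lt_trans (ler_norm c) _.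
  rewrite mulrC -ltr_pdivrMr //; apply: lt_le_trans (truncnS_gt _) _.
  by rewrite ler_nat.
have := le_lt_trans (ler_norm _) E1.
rewrite -/(M n); move: Fle ck.
move: (trace_norm _) (trace_norm _) (c / _) => x y z; lra.
Qed.

(** At a positive rate some large n has at least one output copy; there the halved error is at least
    e / 2 by the gap and below e / 2 by convergence. *)
Lemma achievable_asymmetric r : ~~ (sym_group U rho \subset sym_group U' sigma) ->
  achievable covGP r -> r <= 0.
Proof.
move=> /fintype.subsetPn [g]; rewrite !inE => /eqP g_rho g_sigma.
move=> [r_ge0 [E [EO /cvg0_seqP E0]]].
rewrite leNgt; apply/negP => r0.
have [e e0 gap] := asymmetry_gap rho_state sigma_state U_rep U'_rep g_rho g_sigma.
have [N1 N1P] := E0 (e / 2) (divr_gt0 e0 (ltr0n R 2)).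
have [N2 N2P] := linear_unbounded 1 r0.
have /N1P := leq_maxl N1 N2; have := N2P _ (leq_maxr N1 N2).
have [Ec [Ecov _]] := EO (maxn N1 N2).
rewrite -truncn_gt0; case: (Num.truncn _) (E _) Ec Ecov => // m F Fc Fcov _.
have := gap _ _ F Fc Fcov.
move=> eF; rewrite ger0_norm; first lra.
by rewrite mulr_ge0 ?invr_ge0 // (le_trans (ltW e0) eF).
Qed.

End Rates.

Theorem theorem10 (R : realType) (G : finGroupType) (d d' : nat)
    (rho H : 'M[R[i]]_d) (sigma H' : 'M[R[i]]_d')
    (U : G -> 'M[R[i]]_d) (U' : G -> 'M[R[i]]_d') (beta : R)
    (rho_state : is_state rho) (sigma_state : is_state sigma)
    (H_herm : H \is hermsymmx) (H'_herm : H' \is hermsymmx)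
    (U_rep : proj_unitary_rep U) (U'_rep : proj_unitary_rep U')
    (UH : forall g : G, comm_mx (U g) H)
    (U'H' : forall g : G, comm_mx (U' g) H')
    (beta_gt0 : 0 < beta) :
  R_cov_GP beta U U' H H' rho sigma =
  if sym_group U rho \subset sym_group U' sigma
  then R_GP beta H H' rho sigma else 0%:E.
Proof.
have Hh : H^t* = H.
  by move/is_hermitianmxP: H_herm; rewrite expr0 scale1r => <-.
have H'h : H'^t* = H'.
  by move/is_hermitianmxP: H'_herm; rewrite expr0 scale1r => <-.
have cov0 := achievable_cov0 beta sigma U' rho_state Hh H'h U_rep.
have cov_ge0 : (0%:E <= R_cov_GP beta U U' H H' rho sigma)%E.
  by apply: ereal_sup_ubound; exists 0.
case: ifPn => sub; apply/eqP; rewrite eq_le; apply/andP; split=> //.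
- apply: ereal_sup_le => _ [r /= cov_r <-]; exists r => //.
  exact: (achievable_cov_GP cov_r).
- apply: ge_ereal_sup => _ [r /= GP_r <-].
  rewrite leNgt; apply/negP => lt_r.
  (* The lower bound 0 excludes -oo and [lt_r] excludes +oo, so the covariant rate is a real s <
     r. *)
  case RE : (R_cov_GP beta U U' H H' rho sigma) cov_ge0 lt_r => [s||] //.
  rewrite lee_fin lte_fin => s0 sr.
  (* The midpoint lies strictly below r, hence is achievable covariantly, yet it exceeds the
     supremum s. *)
  have sr' : 0 < (s + r) / 2 < r by apply/andP; split; lra.
  have cov_sr := achievable_GP_cov rho_state sigma_state Hh H'h U_rep U'_rep
    UH U'H' sub GP_r sr'.
  have : (((s + r) / 2)%:E <= R_cov_GP beta U U' H H' rho sigma)%E.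
    by apply: ereal_sup_ubound; exists ((s + r) / 2).
  by rewrite RE lee_fin; lra.
- apply: ge_ereal_sup => _ [r /= cov_r <-]; rewrite lee_fin.
  exact: (achievable_asymmetric rho_state sigma_state U_rep U'_rep sub cov_r).
Qed.
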